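(* For $n\ge 1$ let $\mathcal{X}_n=\coprod_{m=0}^{n-1}\mathrm{GL}_m$, with counting function $$N_{\mathcal{X}_n}(q)=1+\sum_{m=1}^{n-1}q^{m(m-1)/2}(q-1)(q^2-1)\cdots(q^m-1).$$ Then $N_{\mathcal{X}_n}(1-n)\ge 0$ for every odd $n\ge 1$. Hence the ind-variety $\mathcal{X}=\coprod_{m=0}^{\infty}\mathrm{GL}_m=\varinjlim_n\mathcal{X}_n$ has an $\mathbb{F}_\zeta$-structure for all roots of unity $\zeta$ of odd order.
   Context: All varieties are over $\mathbb{Z}$; $\mathrm{GL}_0$ is a point. For a variety $X$, $N_X(q)=\#X(\mathbb{F}_q)$ for prime powers $q$; when this is given by a polynomial in $q$, the polynomial is also denoted $N_X$ and may be evaluated at any integer. $K_0(\mathcal{V}_{\mathbb{Z}})$ is the Grothendieck ring of varieties over $\mathbb{Z}$, generated by isomorphism classes $[X]$ with $[X]=[Y]+[X\smallsetminus Y]$ for closed $Y\subset X$ and $[X\times Y]=[X][Y]$; $\mathbb{L}=[\mathbb{A}^1]$, $\mathbb{T}=\mathbb{L}-1=[\mathbb{G}_m]$. A geometric torification of a variety $X$ is a morphism $e:T\to X$ with $T=\coprod_{j}T_j$, $T_j=\mathbb{G}_m^{k_j}$, such that each $e|_{T_j}$ is an immersion and $e$ induces a bijection $T(k)\simeq X(k)$ for every field $k$. An ind-variety $\mathcal{X}=\varinjlim_N\mathcal{X}_N$ over $\mathbb{Z}$ has an $\mathbb{F}_1$-structure if: (i) the $\mathcal{X}_N$ have a decomposition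 of the form $$\mathcal{X}_N=\bigsqcup_{m=0}^{N-1}X_m\times(\mathbb{A}^m\smallsetminus\{0\})\times\cdots\times(\mathbb{A}^2\smallsetminus\{0\})\times(\mathbb{A}^1\smallsetminus\{0\})$$ (meaning that both sides can be partitioned into finitely many locally closed subvarieties that are pairwise isomorphic), where the varieties $X_m$ admit a geometric torification by tori $\mathbb{G}_m^{k_j}$; (ii) the classes $[\mathcal{X}_N]$ define an element $\sum_{m\ge0}\alpha_m(\mathbb{L})(\mathbb{L}^m-1)\cdots(\mathbb{L}-1)$ of $\varprojlim_n\mathbb{Z}[\mathbb{L}]/((\mathbb{L}-1)\cdots(\mathbb{L}^n-1))$, where $[X_m]=\alpha_m(\mathbb{L})=\sum_j\mathbb{T}^{k_j}$; (iii) the counting functions $N_{\mathcal{X}_N}(q)$ determine the element $\sum_{m\ge0}\alpha_m(q)(q^m-1)\cdots(q-1)$ of the Habiro ring $\varprojlim_n\mathbb{Z}[q]/((1-q)\cdots(1-q^n))$, where $\alpha_m(q)=N_{X_m}(q)=\sum_j(q-1)^{k_j}$. For $\zeta$ a root of unity of order $n$, $\mathcal{X}$ has an $\mathbb{F}_\zeta$-structure if it has an $\mathbb{F}_1$-structure and the polynomial $N_{\mathcal{X}_n}(q)=\sum_{m=0}^{n-1}\alpha_m(q)(q^m-1)\cdots(q-1)$ satisfies $N_{\mathcal{X}_n}(1-n)\ge0$. *)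

(* Defs.v *)
From HB Require Import structures.
From mathcomp Require Import all_boot all_order all_algebra all_field.
From mathcomp Require Import boolp.
From mathcomp Require Import ring.

Set Implicit Arguments.
Unset Strict Implicit.
Unset Printing Implicit Defensive.

Import GRing.Theory.
Local Open Scope ring_scope.

(* Schemes over Z are handled through their functors of points on commutative
   rings (Demazure-Gabriel): by Yoneda, morphisms of schemes are the natural
   transformations. The zero ring is a test ring, hence comPzRingType. *)
Record zfunctor := ZFunctor {
  pts :> comPzRingType -> Type;
  fmap : forall R S : comPzRingType, {rmorphism R -> S} -> pts R -> pts S;
  fmap_id : forall (R : comPzRingType) (x : pts R), fmap idfun x = x;
  fmap_comp : forall (R S T : comPzRingType)
    (g : {rmorphism S -> T}) (f : {rmorphism R -> S}) (x : pts R),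
    fmap (g \o f) x = fmap g (fmap f x)
}.
Arguments fmap X [R S] f x : rename.

Record mor (X Y : zfunctor) := Mor {
  mor_fun :> forall R : comPzRingType, X R -> Y R;
  mor_nat : forall (R S : comPzRingType) (f : {rmorphism R -> S}) (x : X R),
    mor_fun (fmap X f x) = fmap Y f (mor_fun x)
}.
Arguments mor_fun [X Y] _ [R] _.

Definition isomorphic (X Y : zfunctor) : Prop :=
  exists f : mor X Y, forall R : comPzRingType, bijective (@mor_fun X Y f R).

Record subfunctor (X : zfunctor) := SubFunctor {
  sf_in :> forall R : comPzRingType, X R -> Prop;
  sf_map : forall (R S : comPzRingType) (f : {rmorphism R -> S}) (x : X R),
    sf_in x -> sf_in (fmap X f x)
}.
Arguments sf_in [X] _ [R] _.

Lemma rmorph_ext (R S : comPzRingType) (f g : {rmorphism R -> S}) :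
  f =1 g -> f = g.
Proof.
case: f g => f cf [g cg] /= /funext efg; subst g; congr GRing.RMorphism.Pack.
case: cf cg => [[a1] [a2]] [[b1] [b2]].
by rewrite (Prop_irrelevance a1 b1) (Prop_irrelevance a2 b2).
Qed.

Lemma mor_ext (X Y : zfunctor) (f g : mor X Y) :
  (forall (R : comPzRingType) (x : X R), f R x = g R x) -> f = g.
Proof.
case: f g => f nf [g ng] /= efg.
have e : f = g by apply: functional_extensionality_dep => R; apply/funext/efg.
by subst g; rewrite (Prop_irrelevance nf ng).
Qed.

Section Sub.
Variables (X : zfunctor) (U : subfunctor X).

Definition sub_pts (R : comPzRingType) : Type := {x : X R | U R x}.

Definition sub_fmap (R S : comPzRingType) (f : {rmorphism R -> S})
    (x : sub_pts R) : sub_pts S :=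
  exist _ (fmap X f (sval x)) (sf_map f (svalP x)).

Fact sub_fmap_id (R : comPzRingType) (x : sub_pts R) : sub_fmap idfun x = x.
Proof. by case: x => x Ux; apply: eq_exist; rewrite fmap_id. Qed.

Fact sub_fmap_comp (R S T : comPzRingType) (g : {rmorphism S -> T})
    (f : {rmorphism R -> S}) (x : sub_pts R) :
  sub_fmap (g \o f) x = sub_fmap g (sub_fmap f x).
Proof. by apply: eq_exist; rewrite fmap_comp. Qed.

Definition sub : zfunctor := ZFunctor sub_fmap_id sub_fmap_comp.

End Sub.

Section OpenClosed.
Variable X : zfunctor.

(* For every x : Spec A -> X, the inverse image of U is the open D(I) for some
   I in A: f factors through D(I) iff f(I) generates the unit ideal. *)
Definition is_open (U : subfunctor X) : Prop :=
  forall (A : comPzRingType) (x : X A), exists I : A -> Prop,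
  forall (R : comPzRingType) (f : {rmorphism A -> R}),
    U R (fmap X f x) <->
    exists (n : nat) (a : 'I_n -> A) (c : 'I_n -> R),
      (forall i, I (a i)) /\ \sum_(i < n) c i * f (a i) = 1.

(* For every x : Spec A -> X with values in U, the inverse image of Z is the
   closed subscheme V(I) for some I in A. *)
Definition is_closed_in (U Z : subfunctor X) : Prop :=
  forall (A : comPzRingType) (x : X A), U A x -> exists I : A -> Prop,
  forall (R : comPzRingType) (f : {rmorphism A -> R}),
    Z R (fmap X f x) <-> forall a, I a -> f a = 0.

Definition full_sub : subfunctor X :=
  @SubFunctor X (fun _ _ => True) (fun _ _ _ _ _ => Logic.I).

Definition is_closed (Z : subfunctor X) : Prop := is_closed_in full_sub Z.

Definition is_locally_closed (Z : subfunctor X) : Prop :=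
  exists U : subfunctor X, [/\ is_open U,
    forall (R : comPzRingType) (x : X R), Z R x -> U R x & is_closed_in U Z].

(* x : Spec R -> X misses Z iff the pullback of Z along x is empty. *)
Definition compl_in (Z : subfunctor X) (R : comPzRingType) (x : X R) : Prop :=
  forall (S : comPzRingType) (f : {rmorphism R -> S}),
    Z S (fmap X f x) -> 1 = 0 :> S.

Fact compl_map (Z : subfunctor X) (R S : comPzRingType)
    (f : {rmorphism R -> S}) (x : X R) :
  compl_in Z x -> compl_in Z (fmap X f x).
Proof. by move=> Zx T g; rewrite -fmap_comp => /Zx. Qed.

Definition compl (Z : subfunctor X) : subfunctor X :=
  SubFunctor (@compl_map Z).

End OpenClosed.

Definition image_is (Y X : zfunctor) (f : mor Y X) (Z : subfunctor X) : Prop :=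
  forall R : comPzRingType, injective (@mor_fun Y X f R) /\
    (forall x : X R, Z R x <-> exists y : Y R, f R y = x).

Definition is_closed_immersion (Y X : zfunctor) (f : mor Y X) : Prop :=
  exists Z : subfunctor X, is_closed Z /\ image_is f Z.

Definition is_immersion (Y X : zfunctor) (f : mor Y X) : Prop :=
  exists Z : subfunctor X, is_locally_closed Z /\ image_is f Z.

(* f makes S the localization of R at the powers of r. *)
Definition is_localization (R S : comPzRingType) (r : R) (f : R -> S) : Prop :=
  [/\ exists s : S, f r * s = 1,
      forall s : S, exists (a : R) (k : nat), s * f r ^+ k = f a
    & forall a : R, f a = 0 -> exists k : nat, r ^+ k * a = 0].

(* Zariski sheaf: X(R) is the equalizer of prod_i X(R_{r_i}) and
   prod_{i,j} X(R_{r_i r_j}) whenever the r_i generate the unit ideal. *)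
Definition is_zariski_sheaf (X : zfunctor) : Prop :=
  forall (R : comPzRingType) (n : nat) (r c : 'I_n -> R)
    (Rl : 'I_n -> comPzRingType) (phi : forall i, {rmorphism R -> Rl i})
    (Rll : 'I_n -> 'I_n -> comPzRingType)
    (p : forall i j, {rmorphism Rl i -> Rll i j})
    (q : forall i j, {rmorphism Rl j -> Rll i j}),
  \sum_(i < n) c i * r i = 1 ->
  (forall i, is_localization (r i) (phi i)) ->
  (forall i j (a : R), p i j (phi i a) = q i j (phi j a)) ->
  (forall i j, is_localization (r i * r j) (fun a => p i j (phi i a))) ->
  forall x : forall i, X (Rl i),
  (forall i j, fmap X (p i j) (x i) = fmap X (q i j) (x j)) ->
  exists! y : X R, forall i, fmap X (phi i) y = x i.

(* The diagonal is closed. *)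
Definition is_separated (X : zfunctor) : Prop :=
  forall (A : comPzRingType) (x y : X A), exists I : A -> Prop,
  forall (R : comPzRingType) (f : {rmorphism A -> R}),
    fmap X f x = fmap X f y <-> forall a, I a -> f a = 0.

Section Spec.
Variable A : comPzRingType.

Definition spec_fmap (R S : comPzRingType) (f : {rmorphism R -> S})
    (x : {rmorphism A -> R}) : {rmorphism A -> S} := f \o x.

Fact spec_fmap_id (R : comPzRingType) (x : {rmorphism A -> R}) :
  spec_fmap idfun x = x.
Proof. exact: rmorph_ext. Qed.

Fact spec_fmap_comp (R S T : comPzRingType) (g : {rmorphism S -> T})
    (f : {rmorphism R -> S}) (x : {rmorphism A -> R}) :
  spec_fmap (g \o f) x = spec_fmap g (spec_fmap f x).
Proof. exact: rmorph_ext. Qed.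

Definition Spec : zfunctor := ZFunctor spec_fmap_id spec_fmap_comp.

End Spec.

(* Finitely generated as a ring, i.e. as a Z-algebra. *)
Definition finitely_generated (A : comPzRingType) : Prop :=
  exists (n : nat) (a : 'I_n -> A), forall P : A -> Prop,
    (forall i, P (a i)) -> P 1 -> (forall x y, P x -> P y -> P (x - y)) ->
    (forall x y, P x -> P y -> P (x * y)) -> forall x, P x.

(* A separated scheme of finite type over Z: a sheaf with a finite open cover by
   spectra of finitely generated rings. Reducedness is not required: it is not
   preserved by products over Z. *)
Definition is_variety (X : zfunctor) : Prop :=
  [/\ is_zariski_sheaf X, is_separated X &
   exists (n : nat) (U : 'I_n -> subfunctor X) (A : 'I_n -> comPzRingType),
   [/\ forall i, is_open (U i),
       forall i, finitely_generated (A i) /\ isomorphic (sub (U i)) (Spec (A i))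
     & forall (k : fieldType) (x : X k), exists i, U i k x]].

Record variety := Variety { vfun :> zfunctor; varietyP : is_variety vfun }.

(* Two locally closed subschemes are set-theoretically disjoint iff they have no
   common point over a field, and likewise for covering. *)
Definition is_partition (X : zfunctor) (r : nat) (Y : 'I_r -> subfunctor X) :
    Prop :=
  (forall i, is_locally_closed (Y i)) /\
  (forall (k : fieldType) (x : X k), exists! i, Y i k x).

Definition piecewise_isomorphic (X Y : zfunctor) : Prop :=
  exists (r : nat) (P : 'I_r -> subfunctor X) (Q : 'I_r -> subfunctor Y),
    [/\ is_partition P, is_partition Q
      & forall i, isomorphic (sub (P i)) (sub (Q i))].

Definition pt : zfunctor :=
  @ZFunctor (fun=> unit) (fun _ _ _ x => x)
    (fun _ _ => erefl) (fun _ _ _ _ _ _ => erefl).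

Section Prod.
Variables X Y : zfunctor.

Definition prod_fmap (R S : comPzRingType) (f : {rmorphism R -> S})
  (x : X R * Y R) : X S * Y S := (fmap X f x.1, fmap Y f x.2).

Fact prod_fmap_id (R : comPzRingType) (x : X R * Y R) : prod_fmap idfun x = x.
Proof. by case: x => x y; rewrite /prod_fmap !fmap_id. Qed.

Fact prod_fmap_comp (R S T : comPzRingType) (g : {rmorphism S -> T})
    (f : {rmorphism R -> S}) (x : X R * Y R) :
  prod_fmap (g \o f) x = prod_fmap g (prod_fmap f x).
Proof. by rewrite /prod_fmap !fmap_comp. Qed.

Definition prodf : zfunctor :=
  @ZFunctor (fun R => (X R * Y R)%type) prod_fmap prod_fmap_id prod_fmap_comp.

End Prod.

Section Matrices.
Variables m n : nat.

Fact mat_fmap_id (R : comPzRingType) (x : 'M[R]_(m, n)) : map_mx idfun x = x.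
Proof. exact: map_mx_id. Qed.

Fact mat_fmap_comp (R S T : comPzRingType) (g : {rmorphism S -> T})
    (f : {rmorphism R -> S}) (x : 'M[R]_(m, n)) :
  map_mx (g \o f) x = map_mx g (map_mx f x).
Proof. exact: map_mx_comp. Qed.

Definition Mat : zfunctor :=
  @ZFunctor (fun R => 'M[R]_(m, n)) (fun R S f => map_mx f)
    mat_fmap_id mat_fmap_comp.

End Matrices.

Definition Aff (n : nat) : zfunctor := Mat 1 n.

Definition origin (n : nat) : subfunctor (Aff n).
Proof.
by exists (fun (R : comPzRingType) (x : 'rV[R]_n) => x = 0) => R S f x ->; apply: map_mx0.
Defined.

Definition Aff_minus0 (n : nat) : zfunctor := sub (compl (origin n)).

Definition torus_sub (k : nat) : subfunctor (Aff k).
Proof.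
exists (fun (R : comPzRingType) (x : 'rV[R]_k) => forall i, exists y : R, x 0 i * y = 1).
move=> R S f x xU i.
by have [y xy] := xU i; exists (f y); rewrite mxE -rmorphM xy rmorph1.
Defined.

Definition torus (k : nat) : zfunctor := sub (torus_sub k).

Definition GL_sub (m : nat) : subfunctor (Mat m m).
Proof.
exists (fun (R : comPzRingType) (A : 'M[R]_m) =>
  exists B : 'M[R]_m, A *m B = 1%:M /\ B *m A = 1%:M).
move=> R S f A [B [AB BA]]; exists (map_mx f B).
by rewrite -!map_mxM AB BA map_mx1.
Defined.

Definition GL (m : nat) : zfunctor := sub (GL_sub m).

(* (A^m \ 0) x ... x (A^1 \ 0) *)
Fixpoint flag_prod (m : nat) : zfunctor :=
  if m is m'.+1 then prodf (Aff_minus0 m) (flag_prod m') else pt.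

Section Eval.
Variables (R : comPzRingType) (t : R).

Definition peval (p : {poly int}) : R :=
  \sum_(i < size p) (p`_i)%:~R * t ^+ i.

Lemma pevalE n (p : {poly int}) : (size p <= n)%N ->
  peval p = \sum_(i < n) (p`_i)%:~R * t ^+ i.
Proof.
move=> pn; rewrite /peval (big_ord_widen n (fun i => (p`_i)%:~R * t ^+ i)) //.
rewrite big_mkcond; apply: eq_bigr => i _; case: ltnP => // pi.
by rewrite nth_default // mulr0z mul0r.
Qed.

Fact peval_is_zmod_morphism : zmod_morphism peval.
Proof.
move=> p q; pose n := maxn (size p) (size q).
rewrite !(@pevalE n) ?leq_maxl ?leq_maxr //; last first.
  by rewrite (leq_trans (size_polyD _ _)) // size_polyN.
by rewrite -sumrB; apply: eq_bigr => i _; rewrite coefB intrB mulrBl.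
Qed.
HB.instance Definition _ :=
  GRing.isZmodMorphism.Build {poly int} R peval peval_is_zmod_morphism.

Lemma pevalC (c : int) : peval c%:P = c%:~R.
Proof.
by rewrite (@pevalE 1) ?size_polyC ?leq_b1 // big_ord1 coefC /= mulr1.
Qed.

Lemma pevalMX (p : {poly int}) : peval (p * 'X) = peval p * t.
Proof.
have sp : (size (p * 'X)%R <= (size p).+1)%N.
  by rewrite (leq_trans (size_polyMleq _ _)) // size_polyX addn2.
rewrite (pevalE sp) big_ord_recl coefMX mul0r add0r /peval mulr_suml.
by apply: eq_bigr => i _; rewrite coefMX /= exprSr mulrA.
Qed.

Lemma pevalX : peval 'X = t.
Proof. by rewrite -[X in peval X]mul1r pevalMX pevalC mul1r. Qed.

Lemma pevalCM (c : int) (p : {poly int}) : peval (c%:P * p) = c%:~R * peval p.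
Proof.
have sp : (size (c%:P * p)%R <= size p)%N by rewrite mul_polyC size_scale_leq.
rewrite (pevalE sp) /peval mulr_sumr.
by apply: eq_bigr => i _; rewrite coefCM intrM mulrA.
Qed.

Fact peval_is_monoid_morphism : GRing.monoid_morphism peval.
Proof.
split=> [|p q]; first by rewrite pevalC.
elim/poly_ind: p => [|p c IHp]; first by rewrite mul0r raddf0 mul0r.
rewrite mulrDl mulrAC !raddfD /= pevalCM pevalC !pevalMX IHp mulrDl.
by rewrite mulrAC.
Qed.
HB.instance Definition _ :=
  GRing.isMonoidMorphism.Build {poly int} R peval peval_is_monoid_morphism.

End Eval.

Lemma rmorph_polyint (R : comPzRingType) (f : {rmorphism {poly int} -> R}) p :
  f p = peval (f 'X) p.
Proof.
elim/poly_ind: p => [|p c IHp]; first by rewrite !rmorph0.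
rewrite !rmorphD !rmorphM /= -IHp pevalX; congr (_ + _).
by rewrite pevalC -[X in X%:P]intz (rmorph_int polyC) rmorph_int.
Qed.

Lemma fg_polyint : finitely_generated ({poly int} : comPzRingType).
Proof.
exists 1%N, (fun=> 'X) => P PX P1 PB PM.
have P0 : P 0 by rewrite -(subrr 1); apply: PB.
have PN x : P x -> P (- x) by move=> Px; rewrite -sub0r; apply: PB.
have PD x y : P x -> P y -> P (x + y).
  by move=> Px Py; rewrite -[y]opprK; apply/PB/PN.
elim/poly_ind => [//|p c Pp]; apply: (PD); first exact: (PM _ _ Pp (PX ord0)).
have Pn n : P (n%:R) by elim: n => [//|n IHn]; rewrite -natr1; apply: PD.
rewrite -[c]intz (rmorph_int polyC); case: c => n; first exact: Pn.
by rewrite NegzE mulrNz; apply/PN/Pn.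
Qed.

Section Glue.
Variables (R : comPzRingType) (n : nat).
Variables (r c : 'I_n -> R) (Rl : 'I_n -> comPzRingType).
Variable phi : forall i, {rmorphism R -> Rl i}.
Variable Rll : 'I_n -> 'I_n -> comPzRingType.
Variables (p : forall i j, {rmorphism Rl i -> Rll i j}).
Variables (q : forall i j, {rmorphism Rl j -> Rll i j}).
Hypothesis rc : \sum_(i < n) c i * r i = 1.
Hypothesis loc : forall i, is_localization (r i) (phi i).
Hypothesis pq : forall i j (a : R), p i j (phi i a) = q i j (phi j a).
Hypothesis loc2 : forall i j,
  is_localization (r i * r j) (fun a => p i j (phi i a)).

Lemma unimodular_pow k : exists b : 'I_n -> R, \sum_(i < n) b i * r i ^+ k = 1.
Proof.
suff main (s : seq 'I_n) : exists b : 'I_n -> R,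
    \sum_i b i * r i ^+ (if i \in s then k else 1) = 1.
  have [b <-] := main (enum 'I_n).
  by exists b; apply: eq_bigr => i _; rewrite mem_enum.
elim: s => [|j s [b bE]]; first by exists c.
have [js|js] := boolP (j \in s).
  exists b; rewrite -[RHS]bE; apply: eq_bigr => i _.
  by rewrite in_cons; case: eqP => // ->; rewrite js.
move: bE; rewrite (bigD1 j) //= (negPf js) expr1.
set z := \sum_(i | _) _ => bE.
have [w wE] : exists w, 1 = (b j * r j) ^+ k + w * z.
  exists (\sum_(i < k) 1 ^+ (k.-1 - i) * (b j * r j) ^+ i).
  have e : 1 - b j * r j = z by apply/eqP; rewrite subr_eq -bE addrC.
  have := subrXX 1 (b j * r j) k; rewrite expr1n e [z * _]mulrC => <-.
  by rewrite addrC subrK.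
exists (fun i => if i == j then b j ^+ k else w * b i).
rewrite (bigD1 j) //= eqxx mem_head -exprMn [RHS]wE; congr (_ + _).
rewrite mulr_sumr; apply: eq_bigr => i ij.
by rewrite in_cons (negPf ij) mulrA.
Qed.

Lemma common_pow (P : 'I_n -> nat -> Prop) :
  (forall i k l, P i k -> (k <= l)%N -> P i l) ->
  (forall i, exists k, P i k) -> exists k, forall i, P i k.
Proof.
move=> Pm /fin_all_exists[k kP]; exists (\max_i k i)%N => i.
by apply: Pm (kP i) _; apply: leq_bigmax.
Qed.

Lemma glue (x : forall i, Rl i) :
  (forall i j, p i j (x i) = q i j (x j)) ->
  exists! y : R, forall i, phi i y = x i.
Proof.
move=> xpq.
have zero (d : R) : (forall i, phi i d = 0) -> d = 0.
  move=> d0; have [||k kP] := @common_pow (fun i k => r i ^+ k * d = 0).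
  - by move=> i k l kd kl; rewrite -(subnK kl) exprD -mulrA kd mulr0.
  - by move=> i; have [_ _] := loc i; apply; apply: d0.
  have [b bE] := unimodular_pow k.
  rewrite -[d]mul1r -bE mulr_suml big1 // => i _.
  by rewrite -mulrA kP mulr0.
have [||k kP] :=
    @common_pow (fun i k => exists a, x i * phi i (r i) ^+ k = phi i a).
- move=> i k l [a aE] kl; exists (a * r i ^+ (l - k)).
  by rewrite rmorphM -aE rmorphXn -mulrA -exprD subnKC.
- by move=> i; have [_ h _] := loc i; have [a [k kE]] := h (x i); exists k, a.
have {kP} [a aE] := fin_all_exists kP.
have [||K KP] := @common_pow (fun i K => forall j,
    (r i * r j) ^+ K * (a i * r j ^+ k - a j * r i ^+ k) = 0).
- by move=> i K l KP Kl j; rewrite -(subnK Kl) exprD -mulrA KP mulr0.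
- move=> i.
  suff [K KP] : exists K, forall j,
      (r i * r j) ^+ K * (a i * r j ^+ k - a j * r i ^+ k) = 0 by exists K.
  apply: common_pow => [j K l KP Kl|j].
    by rewrite -(subnK Kl) exprD -mulrA KP mulr0.
  have [_ _] := loc2 i j; apply.
  rewrite rmorphB !rmorphM !rmorphXn rmorphB !rmorphM !rmorphXn -!aE.
  rewrite [phi i (a j)]lock.
  rewrite !rmorphM !rmorphXn -lock !pq -aE rmorphM rmorphXn /= xpq.
  by ring.
have [b bE] := unimodular_pow (k + K).
pose y := \sum_j b j * (a j * r j ^+ K).
have yE i : y * r i ^+ (k + K) = a i * r i ^+ K.
  rewrite -[RHS]mul1r -bE !mulr_suml; apply: eq_bigr => j _.
  have := KP i j; rewrite mulrBr => /subr0_eq; rewrite exprMn !exprD => e.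
  transitivity (b j * (r i ^+ K * r j ^+ K * (a j * r i ^+ k))); first by ring.
  by rewrite -e; ring.
have yphi i : phi i y = x i.
  have [[s sE] _ _] := loc i.
  have sK : phi i (r i) ^+ (k + K) * s ^+ (k + K) = 1.
    by rewrite -exprMn sE expr1n.
  rewrite -[LHS]mulr1 -sK mulrA -rmorphXn -rmorphM yE rmorphM rmorphXn -aE.
  by rewrite -[x i * _ * _]mulrA -exprD -mulrA sK mulr1.
exists y; split=> // y' y'E; apply/subr0_eq/zero => i.
by rewrite rmorphB yphi y'E subrr.
Qed.
End Glue.

Lemma Aff1_variety : is_variety (Aff 1).
Proof.
split.
- move=> R n r c Rl phi Rll p q rc loc pq loc2 x xpq.
  have [|y [yE yU]] := @glue R n r c Rl phi Rll p q rc loc pq loc2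
    (fun i => (x i : 'rV_1) 0 0).
  - by move=> i j; have /(congr1 (fun M : 'rV_1 => M 0 0)) := xpq i j; rewrite !mxE.
  exists (\row__ y); split=> [i|y' y'E].
    by apply/rowP => j; rewrite !mxE ord1 yE.
  apply/rowP => j; rewrite ord1 mxE; apply: yU => i.
  by rewrite -y'E mxE.
- move=> A x y; exists (fun a => a = (x : 'rV_1) 0 0 - (y : 'rV_1) 0 0) => R f.
  split=> [/rowP/(_ 0)|h]; first by rewrite !mxE => e a ->; rewrite rmorphB e subrr.
  apply/rowP => j; rewrite ord1 !mxE; apply/subr0_eq.
  by rewrite -rmorphB; apply: h.
exists 1%N, (fun=> full_sub (Aff 1)), (fun=> ({poly int} : comPzRingType)).
split; [|split|by exists 0].
- move=> i A x; exists (fun=> True) => R f; split=> // _.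
  by exists 1%N, (fun=> 1), (fun=> 1); rewrite big_ord1 rmorph1 mulr1.
- exact: fg_polyint.
pose ev R (x : sub (full_sub (Aff 1)) R) : Spec {poly int} R :=
  peval ((sval x : 'rV_1) 0 0).
have evN (R S : comPzRingType) (f : {rmorphism R -> S}) x :
    ev S (fmap (sub (full_sub (Aff 1))) f x) = fmap (Spec {poly int}) f (ev R x).
  apply: rmorph_ext => a; rewrite [RHS]rmorph_polyint /= pevalX.
  by rewrite /ev /= mxE.
exists (Mor evN) => R.
exists (fun h : Spec {poly int} R =>
          exist (full_sub (Aff 1) R) (\row__ h 'X) Logic.I).
- move=> [x []]; apply: eq_exist; apply/rowP => j.
  by rewrite mxE ord1 /= pevalX.
- by move=> h; apply: rmorph_ext => a; rewrite /= [RHS]rmorph_polyint mxE.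
Qed.

Definition affine_line : variety := Variety Aff1_variety.

(* The open subscheme Spec R_e of Spec R; it is clopen when e is idempotent. *)
Definition Dopen (R : comPzRingType) (e : R) : subfunctor (Spec R).
Proof.
exists (fun S (f : Spec R S) => f e = 1) => S T g f /= fe.
by rewrite fe rmorph1.
Defined.

Section Coproduct.
Variables (n : nat) (X : nat -> zfunctor).

(* A morphism from Spec R to the disjoint union of the X_i, i < n: a partition
   of Spec R into the clopen subschemes D(e_i) and morphisms D(e_i) -> X_i.
   All i : nat are allowed, with e_i = 0 for i >= n, so that the n-th coproduct
   is a subset of the (n+1)-st; for a sheaf X_i there is exactly one morphism
   D(0) -> X_i, because D(0) is empty. *)
Record coprod_pts (R : comPzRingType) : Type := CoprodPts {
  cp_idem : nat -> R;
  cp_mor : forall i, mor (sub (Dopen (cp_idem i))) (X i);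
  cp_orth : forall i j, i != j -> cp_idem i * cp_idem j = 0;
  cp_out : forall i, (n <= i)%N -> cp_idem i = 0;
  cp_sum : \sum_(i < n) cp_idem i = 1
}.

Lemma coprod_pts_ext (R : comPzRingType) (e : nat -> R)
    (x y : forall i, mor (sub (Dopen (e i))) (X i)) o1 o2 u1 u2 s1 s2 :
  (forall i, x i = y i) ->
  @CoprodPts R e x o1 u1 s1 = @CoprodPts R e y o2 u2 s2.
Proof.
move=> xy; have {xy} exy := functional_extensionality_dep xy; subst y.
by rewrite (Prop_irrelevance o1 o2) (Prop_irrelevance u1 u2)
  (Prop_irrelevance s1 s2).
Qed.

Section Map.
Variables (R S : comPzRingType) (g : {rmorphism R -> S}).

(* Restriction along D(g e) -> D(e). *)
Definition Dopen_restr (Y : zfunctor) (e : R) (x : mor (sub (Dopen e)) Y) :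
  mor (sub (Dopen (g e))) Y.
Proof.
exists (fun T (f : sub (Dopen (g e)) T) =>
  x T (exist (Dopen e T) (spec_fmap (sval f) g) (svalP f))).
move=> T T' h [f fe] /=; rewrite -mor_nat; congr (x _ _).
by apply: eq_exist; apply: rmorph_ext.
Defined.

Variable x : coprod_pts R.

Fact coprod_map_orth i j : i != j -> g (cp_idem x i) * g (cp_idem x j) = 0.
Proof. by move=> ij; rewrite -rmorphM cp_orth ?rmorph0. Qed.

Fact coprod_map_out i : (n <= i)%N -> g (cp_idem x i) = 0.
Proof. by move=> ni; rewrite cp_out ?rmorph0. Qed.

Fact coprod_map_sum : \sum_(i < n) g (cp_idem x i) = 1.
Proof. by rewrite -rmorph_sum cp_sum rmorph1. Qed.

Definition coprod_fmap : coprod_pts S :=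
  @CoprodPts S (fun i => g (cp_idem x i)) (fun i => Dopen_restr (cp_mor x i))
    coprod_map_orth coprod_map_out coprod_map_sum.

End Map.

Fact coprod_fmap_id (R : comPzRingType) (x : coprod_pts R) :
  coprod_fmap idfun x = x.
Proof.
case: x => e x o u s; apply: coprod_pts_ext => i; apply: mor_ext => S [f fe] /=.
by congr (x i _ _); apply: eq_exist; apply: rmorph_ext.
Qed.

Fact coprod_fmap_comp (R S T : comPzRingType) (g : {rmorphism S -> T})
    (f : {rmorphism R -> S}) (x : coprod_pts R) :
  coprod_fmap (g \o f) x = coprod_fmap g (coprod_fmap f x).
Proof.
case: x => e x o u s; apply: coprod_pts_ext => i; apply: mor_ext => V [h he] /=.
by congr (x i _ _); apply: eq_exist; apply: rmorph_ext.
Qed.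

Definition coprod : zfunctor := ZFunctor coprod_fmap_id coprod_fmap_comp.

End Coproduct.

Section CoproductIncl.
Variables (n : nat) (X : nat -> zfunctor).

Fact coprod_incl_out (R : comPzRingType) (x : coprod n X R) i :
  (n < i)%N -> cp_idem x i = 0.
Proof. by move=> /ltnW; apply: cp_out. Qed.

Fact coprod_incl_sum (R : comPzRingType) (x : coprod n X R) :
  \sum_(i < n.+1) cp_idem x i = 1.
Proof. by rewrite big_ord_recr /= cp_sum cp_out ?addr0. Qed.

Definition coprod_incl_fun (R : comPzRingType) (x : coprod n X R) :
    coprod n.+1 X R :=
  CoprodPts (cp_mor x) (@cp_orth _ _ _ x) (@coprod_incl_out R x)
    (coprod_incl_sum x).

Definition coprod_incl : mor (coprod n X) (coprod n.+1 X).
Proof.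
by exists (@coprod_incl_fun) => R S f x; apply: coprod_pts_ext.
Defined.

End CoproductIncl.

(* Indexed from 0, but F_1-structures only involve the terms with N >= 1. *)
Record ind_system := IndSystem {
  ind_term :> nat -> zfunctor;
  ind_map : forall N, mor (ind_term N) (ind_term N.+1)
}.

Definition is_ind_variety (X : ind_system) : Prop :=
  (forall N, is_variety (X N)) /\
  (forall N, is_closed_immersion (@ind_map X N)).

Definition GL_ind : ind_system :=
  IndSystem (fun N => coprod_incl N GL).

(* K_0(V_Z) is given by its presentation: K0term modulo K0eq. It is not a
   comPzRingType: it lives in a higher universe than the test rings. *)
Inductive K0term : Type :=
| K0cls of variety
| K0zero
| K0one
| K0add of K0term & K0term
| K0opp of K0term
| K0mul of K0term & K0term.

Inductive K0eq : K0term -> K0term -> Prop :=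
| K0refl a : K0eq a a
| K0sym a b : K0eq a b -> K0eq b a
| K0trans a b c : K0eq a b -> K0eq b c -> K0eq a c
| K0cong_add a a' b b' :
    K0eq a a' -> K0eq b b' -> K0eq (K0add a b) (K0add a' b')
| K0cong_opp a a' : K0eq a a' -> K0eq (K0opp a) (K0opp a')
| K0cong_mul a a' b b' :
    K0eq a a' -> K0eq b b' -> K0eq (K0mul a b) (K0mul a' b')
| K0addA a b c : K0eq (K0add a (K0add b c)) (K0add (K0add a b) c)
| K0addC a b : K0eq (K0add a b) (K0add b a)
| K0add0 a : K0eq (K0add K0zero a) a
| K0addN a : K0eq (K0add (K0opp a) a) K0zero
| K0mulA a b c : K0eq (K0mul a (K0mul b c)) (K0mul (K0mul a b) c)
| K0mulC a b : K0eq (K0mul a b) (K0mul b a)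
| K0mul1 a : K0eq (K0mul K0one a) a
| K0mulDl a b c : K0eq (K0mul (K0add a b) c) (K0add (K0mul a c) (K0mul b c))
| K0iso (X Y : variety) : isomorphic X Y -> K0eq (K0cls X) (K0cls Y)
| K0scissor (X Y U : variety) (Z : subfunctor X) :
    is_closed Z -> isomorphic Y (sub Z) -> isomorphic U (sub (compl Z)) ->
    K0eq (K0cls X) (K0add (K0cls Y) (K0cls U))
| K0pt (P : variety) : isomorphic P pt -> K0eq (K0cls P) K0one
| K0prod (X Y P : variety) : isomorphic P (prodf X Y) ->
    K0eq (K0cls P) (K0mul (K0cls X) (K0cls Y)).

Definition K0L : K0term := K0cls affine_line.

Fixpoint K0nat (n : nat) : K0term :=
  if n is n'.+1 then K0add K0one (K0nat n') else K0zero.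

Definition K0int (z : int) : K0term :=
  match z with Posz n => K0nat n | Negz n => K0opp (K0nat n.+1) end.

Fixpoint K0horner (s : seq int) : K0term :=
  if s is c :: s' then K0add (K0mul (K0horner s') K0L) (K0int c) else K0zero.

(* P(L), by Horner's scheme *)
Definition K0eval (P : {poly int}) : K0term := K0horner P.

Definition has_card (T : Type) (c : nat) : Prop :=
  exists f : 'I_c -> T, bijective f.

(* N_X(q) = P(q) for all prime powers q; this determines P. *)
Definition is_counting_poly (X : zfunctor) (P : {poly int}) : Prop :=
  forall F : finFieldType, exists c : nat,
    has_card (X F) c /\ c%:Z = P.[#|F|%:Z].

(* (q - 1)(q^2 - 1) ... (q^n - 1) *)
Definition qpoch (n : nat) : {poly int} := \prod_(1 <= i < n.+1) ('X^i - 1).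

Definition eqmod_poly (M P Q : {poly int}) : Prop :=
  exists C : {poly int}, P - Q = C * M.

(* An element of the projective limit of the Z[q]/((q - 1) ... (q^n - 1)) is
   represented by a family of polynomials; two families represent the same
   element when their n-th terms agree modulo qpoch n for all n. The ideals are
   those of the (1 - q) ... (1 - q^n). Also used for Z[L] with L for q. *)
Record habiro := Habiro {
  hab_term :> nat -> {poly int};
  hab_coherent : forall n, eqmod_poly (qpoch n) (hab_term n.+1) (hab_term n)
}.

Definition qpoch_sum (alpha : nat -> {poly int}) (n : nat) : {poly int} :=
  \sum_(m < n) alpha m * qpoch m.

Fact qpoch_sum_coherent (alpha : nat -> {poly int}) n :
  eqmod_poly (qpoch n) (qpoch_sum alpha n.+1) (qpoch_sum alpha n).
Proof.
by exists (alpha n); rewrite /qpoch_sum big_ord_recr /= addrAC subrr add0r.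
Qed.

(* The infinite sum of the alpha_m (q^m - 1) ... (q - 1): the terms with m >= n
   vanish modulo qpoch n. *)
Definition habiro_series (alpha : nat -> {poly int}) : habiro :=
  Habiro (qpoch_sum_coherent alpha).

Definition classes_define (X : nat -> variety) (h : habiro) : Prop :=
  forall N, (0 < N)%N -> exists P : {poly int},
    K0eq (K0cls (X N)) (K0eval P) /\ eqmod_poly (qpoch N) P (h N).

Definition counts_define (X : nat -> zfunctor) (h : habiro) : Prop :=
  forall N, (0 < N)%N -> exists P : {poly int},
    is_counting_poly (X N) P /\ eqmod_poly (qpoch N) P (h N).

(* A morphism from the disjoint union T of the G_m^(k_j) is a family of
   morphisms e_j, and T(K) is the disjoint union of the G_m^(k_j)(K) for every
   field K. *)
Definition has_torification (X : zfunctor) (r : nat) (k : 'I_r -> nat) : Prop :=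
  exists e : forall j : 'I_r, mor (torus (k j)) X,
    (forall j, is_immersion (e j)) /\
    (forall K : fieldType, bijective
       (fun p : {j : 'I_r & torus (k j) K} => e (tag p) K (tagged p))).

Record F1_data := F1Data {
  F1_comp : nat -> variety;
  F1_ntori : nat -> nat;
  F1_rank : forall m, 'I_(F1_ntori m) -> nat
}.

Definition F1_alpha (D : F1_data) (m : nat) : {poly int} :=
  \sum_(j < F1_ntori D m) ('X - 1) ^+ (F1_rank j).

Definition is_F1_structure (X : ind_system) (hX : is_ind_variety X)
    (D : F1_data) : Prop :=
  [/\ (forall N, (0 < N)%N -> piecewise_isomorphic (X N)
          (coprod N (fun m => prodf (F1_comp D m) (flag_prod m)))) /\
       (forall m, has_torification (F1_comp D m) (@F1_rank D m)),
      (forall m, K0eq (K0cls (F1_comp D m)) (K0eval (F1_alpha D m))) /\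
       classes_define (fun N => Variety (hX.1 N)) (habiro_series (F1_alpha D))
    & (forall m, is_counting_poly (F1_comp D m) (F1_alpha D m)) /\
       counts_define X (habiro_series (F1_alpha D))].

Definition has_Fzeta_structure (zeta : algC) (X : ind_system) : Prop :=
  exists (n : nat) (hX : is_ind_variety X) (D : F1_data),
    [/\ n.-primitive_root zeta, is_F1_structure hX D,
        is_counting_poly (X n) (qpoch_sum (F1_alpha D) n)
      & 0 <= (qpoch_sum (F1_alpha D) n).[1 - n%:Z]].

(* Main.v *)
Require Import Defs.
From Stdlib Require Import Setoid Ring.
From HB Require Import structures.
From mathcomp Require Import all_boot all_order all_algebra all_fingroup all_field.
From mathcomp Require Import boolp zify.

Set Implicit Arguments.
Unset Strict Implicit.
Unset Printing Implicit Defensive.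

Import GRing.Theory Num.Theory Order.TTheory.
Local Open Scope ring_scope.

(** The sign of [N_(X_n)] at [q = 1 - n] for odd [n] comes from pairing terms.
Let [a_m] be the [m]-th term, so that [a_(m+1) = a_m q^m (q^(m+1) - 1)].  For
[q <= -2] the factor is at most [0] when [m] is even and at most [-1] when [m]
is odd.  Hence [a_m] alternates in sign, and each negative [a_m] with [m] odd
is outweighed by its successor; since [n] is odd, the terms after [a_0 = 1]
split into such pairs ([odd_sum_ge0]).

The rest is geometry.  The point of [GL_(m+1)] given by a matrix [A] has a
pivot, the first nonzero entry of its first column, say in row [i].  The
matrices with pivot [i] correspond to triples made of the first column, the
rest of row [i], and the Schur complement [A_i0 A_rc - A_r0 A_ic], which is
invertible exactly when [A] is ([iso_pivot], [GL_schur]).  Writing the Schur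
complement without denominators makes it a function on all matrices, so that
the sequence of successive pivots cuts [GL_m] into locally closed pieces without
any gluing.  The product of [A^(m(m-1)/2)] with the [A^k - 0] is cut by the
first nonzero coordinates of its factors, and the pieces agree
([iso_mx_piece], [piecewise_GL]).  In the Grothendieck ring the same splitting
is used one coordinate at a time: the columns with pivot [i] are the difference
of two linear subspaces, and the sum telescopes to
[[GL_(m+1)] = (L^(m+1) - 1) L^m [GL_m]] ([K0_GL_rec]).  The components
[A^(m(m-1)/2)] of the F_1-structure are, as sets, disjoint unions of coordinate tori
([Aff_torification]).

That these functors are varieties is obtained from one criterion: a functor
with a closed immersion into an affine space is a variety ([affine_variety]).
Its coordinate ring consists of ring terms modulo agreement on all points.  The
criterion is inherited by closed subfunctors, by loci where a function is
invertible, by products and by finite coproducts ([affine_coprod]), which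
covers every functor whose class is taken.  The finite coproducts are
controlled by the ring [R / (1 - e)], of which [D(e)] is the spectrum when [e]
is idempotent. *)

(** * Quotient rings *)

(** Ring operations that satisfy the axioms only up to a congruence.  Both ideals
of a ring and terms modulo agreement are instances, so that coordinate rings and
quotients by ideals are built once. *)
Record ring_congruence := RingCongruence {
  rc_car : Type;
  rc_rel : rc_car -> rc_car -> Prop;
  rc_zero : rc_car;
  rc_one : rc_car;
  rc_opp : rc_car -> rc_car;
  rc_add : rc_car -> rc_car -> rc_car;
  rc_mul : rc_car -> rc_car -> rc_car;
  rc_refl : forall x, rc_rel x x;
  rc_sym : forall x y, rc_rel x y -> rc_rel y x;
  rc_trans : forall x y z, rc_rel x y -> rc_rel y z -> rc_rel x z;
  rc_oppP : forall x x', rc_rel x x' -> rc_rel (rc_opp x) (rc_opp x');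
  rc_addP : forall x x' y y', rc_rel x x' -> rc_rel y y' ->
    rc_rel (rc_add x y) (rc_add x' y');
  rc_mulP : forall x x' y y', rc_rel x x' -> rc_rel y y' ->
    rc_rel (rc_mul x y) (rc_mul x' y');
  rc_addA : forall x y z, rc_rel (rc_add x (rc_add y z)) (rc_add (rc_add x y) z);
  rc_addC : forall x y, rc_rel (rc_add x y) (rc_add y x);
  rc_add0 : forall x, rc_rel (rc_add rc_zero x) x;
  rc_addN : forall x, rc_rel (rc_add (rc_opp x) x) rc_zero;
  rc_mulA : forall x y z, rc_rel (rc_mul x (rc_mul y z)) (rc_mul (rc_mul x y) z);
  rc_mulC : forall x y, rc_rel (rc_mul x y) (rc_mul y x);
  rc_mul1 : forall x, rc_rel (rc_mul rc_one x) x;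
  rc_mulDl : forall x y z,
    rc_rel (rc_mul (rc_add x y) z) (rc_add (rc_mul x z) (rc_mul y z))
}.

Section CongruenceQuotient.
Variable E : ring_congruence.

(** Equivalence classes are kept as predicates, and representatives chosen
classically; nothing is assumed decidable. *)
Definition cquot : Type := {P : rc_car E -> Prop | exists x, P = rc_rel x}.

Definition cpi (x : rc_car E) : cquot := exist _ (rc_rel x) (ex_intro _ x erefl).

Definition crepr (q : cquot) : rc_car E := sval (cid (svalP q)).

Lemma creprK q : cpi (crepr q) = q.
Proof.
by case: q => P hP; apply: eq_exist; rewrite /crepr /=; case: cid.
Qed.

Lemma cpiP x y : cpi x = cpi y <-> rc_rel x y.
Proof.
split=> [[->]|xy]; first exact: rc_refl.
apply: eq_exist; apply/funext => z; apply/propext; split; last exact: rc_trans.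
by apply: rc_trans; apply: rc_sym.
Qed.

Lemma crel_repr x : rc_rel x (crepr (cpi x)).
Proof. by apply/cpiP; rewrite creprK. Qed.

HB.instance Definition _ := gen_eqMixin cquot.
HB.instance Definition _ := gen_choiceMixin cquot.

Definition cq_opp q := cpi (rc_opp (crepr q)).
Definition cq_add p q := cpi (rc_add (crepr p) (crepr q)).
Definition cq_mul p q := cpi (rc_mul (crepr p) (crepr q)).

Lemma cq_oppE x : cq_opp (cpi x) = cpi (rc_opp x).
Proof. by apply/cpiP/rc_oppP/rc_sym/crel_repr. Qed.

Lemma cq_addE x y : cq_add (cpi x) (cpi y) = cpi (rc_add x y).
Proof. by apply/cpiP/rc_addP; apply/rc_sym/crel_repr. Qed.

Lemma cq_mulE x y : cq_mul (cpi x) (cpi y) = cpi (rc_mul x y).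
Proof. by apply/cpiP/rc_mulP; apply/rc_sym/crel_repr. Qed.

Lemma cq_addA : associative cq_add.
Proof.
move=> p q r; rewrite -(creprK p) -(creprK q) -(creprK r) !cq_addE.
exact/cpiP/rc_addA.
Qed.

Lemma cq_addC : commutative cq_add.
Proof.
by move=> p q; rewrite -(creprK p) -(creprK q) !cq_addE; apply/cpiP/rc_addC.
Qed.

Lemma cq_add0 : left_id (cpi (rc_zero E)) cq_add.
Proof. by move=> p; rewrite -(creprK p) cq_addE; apply/cpiP/rc_add0. Qed.

Lemma cq_addN : left_inverse (cpi (rc_zero E)) cq_opp cq_add.
Proof. by move=> p; rewrite -(creprK p) cq_oppE cq_addE; apply/cpiP/rc_addN. Qed.

HB.instance Definition _ :=
  GRing.isZmodule.Build cquot cq_addA cq_addC cq_add0 cq_addN.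

Lemma cq_mulA : associative cq_mul.
Proof.
move=> p q r; rewrite -(creprK p) -(creprK q) -(creprK r) !cq_mulE.
exact/cpiP/rc_mulA.
Qed.

Lemma cq_mulC : commutative cq_mul.
Proof.
by move=> p q; rewrite -(creprK p) -(creprK q) !cq_mulE; apply/cpiP/rc_mulC.
Qed.

Lemma cq_mul1 : left_id (cpi (rc_one E)) cq_mul.
Proof. by move=> p; rewrite -(creprK p) cq_mulE; apply/cpiP/rc_mul1. Qed.

Lemma cq_mulDl : left_distributive cq_mul +%R.
Proof.
move=> p q r; rewrite -(creprK p) -(creprK q) -(creprK r).
rewrite [cpi _ + _]cq_addE !cq_mulE [RHS]cq_addE.
exact/cpiP/rc_mulDl.
Qed.

HB.instance Definition _ :=
  GRing.Zmodule_isComPzRing.Build cquot cq_mulA cq_mulC cq_mul1 cq_mulDl.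

Lemma cpiD x y : cpi (rc_add x y) = cpi x + cpi y.
Proof. by rewrite [RHS]cq_addE. Qed.

Lemma cpiM x y : cpi (rc_mul x y) = cpi x * cpi y.
Proof. by rewrite [RHS]cq_mulE. Qed.

Lemma cpiN x : cpi (rc_opp x) = - cpi x.
Proof. by rewrite [RHS]cq_oppE. Qed.

End CongruenceQuotient.

Record ideal (R : comPzRingType) := Ideal {
  id_in :> R -> Prop;
  id0 : id_in 0;
  idB : forall x y, id_in x -> id_in y -> id_in (x - y);
  idM : forall x y, id_in y -> id_in (x * y)
}.

Section QuotientRing.
Variables (R : comPzRingType) (J : ideal R).

Lemma idN x : J x -> J (- x).
Proof. by move=> Jx; rewrite -sub0r; apply/idB => //; apply: id0. Qed.

Lemma idD x y : J x -> J y -> J (x + y).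
Proof. by move=> Jx Jy; rewrite -[y]opprK; apply/idB/idN. Qed.

Lemma ideal_subrr x y : x = y -> J (x - y).
Proof. by move=> ->; rewrite subrr; apply: id0. Qed.

Definition ideal_congruence : ring_congruence.
Proof.
apply: (@RingCongruence R (fun x y => J (x - y)) 0 1 -%R +%R *%R).
- by move=> x; apply: ideal_subrr.
- by move=> x y /idN; rewrite opprB.
- by move=> x y z xy yz; rewrite -(subrKA y); apply: idD.
- by move=> x x' xx; rewrite -opprD; apply: idN.
- by move=> x x' y y' xx yy; rewrite opprD addrACA; apply: idD.
- move=> x x' y y' xx yy.
  have -> : x * y - x' * y' = y * (x - x') + x' * (y - y').
    by rewrite !mulrBr [y * x]mulrC [y * x']mulrC subrKA.
  by apply: idD; apply: idM.
- by move=> x y z; apply/ideal_subrr/addrA.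
- by move=> x y; apply/ideal_subrr/addrC.
- by move=> x; apply/ideal_subrr/add0r.
- by move=> x; apply/ideal_subrr/addNr.
- by move=> x y z; apply/ideal_subrr/mulrA.
- by move=> x y; apply/ideal_subrr/mulrC.
- by move=> x; apply/ideal_subrr/mul1r.
- by move=> x y z; apply/ideal_subrr/mulrDl.
Defined.

Definition quot : comPzRingType := cquot ideal_congruence.

Definition qpi (x : R) : quot := @cpi ideal_congruence x.

Lemma qpiP x y : qpi x = qpi y <-> J (x - y).
Proof. exact: cpiP. Qed.

Definition qrepr (q : quot) : R := crepr q.

Lemma qreprK q : qpi (qrepr q) = q.
Proof. exact: creprK. Qed.

Fact qpi_zmod : zmod_morphism qpi.
Proof. by move=> x y; rewrite /qpi (@cpiD ideal_congruence) (@cpiN ideal_congruence). Qed.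
HB.instance Definition _ := GRing.isZmodMorphism.Build R quot qpi qpi_zmod.

Fact qpi_mon : GRing.monoid_morphism qpi.
Proof. by split=> // x y; rewrite /qpi (@cpiM ideal_congruence). Qed.
HB.instance Definition _ := GRing.isMonoidMorphism.Build R quot qpi qpi_mon.

Lemma qpi_eq0 x : qpi x = 0 <-> J x.
Proof. by rewrite -[0](rmorph0 qpi) qpiP subr0. Qed.

Section Lift.
Variables (S : comPzRingType) (f : {rmorphism R -> S}).
Hypothesis fJ : forall x, J x -> f x = 0.

Definition qlift (q : quot) : S := f (qrepr q).

Lemma qliftE x : qlift (qpi x) = f x.
Proof.
apply/subr0_eq; rewrite /qlift -rmorphB; apply: fJ.
by apply/qpiP; rewrite qreprK.
Qed.

Fact qlift_zmod : zmod_morphism qlift.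
Proof.
by move=> p q; rewrite -(qreprK p) -(qreprK q) -rmorphB !qliftE rmorphB.
Qed.

Fact qlift_mon : GRing.monoid_morphism qlift.
Proof.
split=> [|p q]; first by rewrite -(rmorph1 qpi) qliftE rmorph1.
by rewrite -(qreprK p) -(qreprK q) -rmorphM !qliftE rmorphM.
Qed.

(** The universal property; equality as morphisms lets [fmap] be factored. *)
Lemma quot_factor : exists g : {rmorphism quot -> S}, g \o qpi = f :> {rmorphism R -> S}.
Proof.
pose z := GRing.isZmodMorphism.Build quot S qlift qlift_zmod.
pose m := GRing.isMonoidMorphism.Build quot S qlift qlift_mon.
pose g : {rmorphism quot -> S} := HB.pack qlift z m.
by exists g; apply: rmorph_ext => x; rewrite /= /g /= qliftE.
Qed.

End Lift.
End QuotientRing.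
Arguments qpi {R} J x.

(** The ideal generated by [I], encoded as the common kernel of all maps killing
[I]: the definition of closed subfunctors tests ideals only through maps. *)
Definition ideal_span (R : comPzRingType) (I : R -> Prop) : ideal R.
Proof.
exists (fun x => forall (S : comPzRingType) (f : {rmorphism R -> S}),
  (forall a, I a -> f a = 0) -> f x = 0).
- by move=> S f _; rewrite rmorph0.
- by move=> x y hx hy S f fI; rewrite rmorphB hx // hy // subrr.
- by move=> x y hy S f fI; rewrite rmorphM hy // mulr0.
Defined.

Lemma ideal_span_gen (R : comPzRingType) (I : R -> Prop) a :
  I a -> ideal_span I a.
Proof. by move=> Ia S f; apply. Qed.

Definition principal (R : comPzRingType) (a : R) : ideal R.
Proof.
exists (fun x => exists c, x = c * a).
- by exists 0; rewrite mul0r.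
- by move=> x y [c ->] [d ->]; exists (c - d); rewrite mulrBl.
- by move=> x y [c ->]; exists (x * c); rewrite mulrA.
Defined.

Lemma principal_gen (R : comPzRingType) (a : R) : qpi (principal a) a = 0.
Proof. by apply/qpi_eq0; exists 1; rewrite mul1r. Qed.

Lemma principal_factor (R S : comPzRingType) (a : R) (f : {rmorphism R -> S}) :
  f a = 0 -> exists g : {rmorphism quot (principal a) -> S},
    g \o qpi (principal a) = f :> {rmorphism R -> S}.
Proof. by move=> fa; apply: quot_factor => x [c ->]; rewrite rmorphM fa mulr0. Qed.

(** The quotient by [a] is the universal ring where [a] vanishes; it is zero
exactly when [a] generates the unit ideal.  So the complement of the zero locus
of a function is where it is invertible. *)
Lemma unit_locus (R : comPzRingType) (a : R) :
  (forall (S : comPzRingType) (f : {rmorphism R -> S}), f a = 0 -> 1 = 0 :> S)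
  <-> exists b, a * b = 1.
Proof.
split=> [h|[b ab] S f fa]; last first.
  by rewrite -(rmorph1 f) -ab rmorphM fa mul0r.
have /qpi_eq0 [c cE] : qpi (principal a) 1 = 0.
  by rewrite rmorph1; apply: (h _ (qpi (principal a))); apply: principal_gen.
by exists c; rewrite mulrC.
Qed.

(** * Morphisms and subfunctors *)

Lemma inj_surj_bij (T U : Type) (f : T -> U) :
  injective f -> (forall y, exists x, f x = y) -> bijective f.
Proof.
move=> fI fS; exists (fun y => sval (cid (fS y))) => [x|y]; last by case: cid.
by apply: fI; case: cid.
Qed.

Lemma bij_surj (T U : Type) (f : T -> U) :
  bijective f -> forall y, exists x, f x = y.
Proof. by case=> g _ gK y; exists (g y). Qed.

Lemma sval_inj_prop (T : Type) (P : T -> Prop) : injective (@sval T P).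
Proof. by case=> x px [y py] /= xy; apply: eq_exist. Qed.

Definition mor_id (X : zfunctor) : mor X X := @Mor X X (fun R x => x) (fun _ _ _ _ => erefl).

Definition mor_comp (X Y Z : zfunctor) (g : mor Y Z) (f : mor X Y) : mor X Z.
Proof.
exists (fun R x => g R (f R x)) => R S h x.
by rewrite !mor_nat.
Defined.

Definition incl (X : zfunctor) (Z : subfunctor X) : mor (sub Z) X.
Proof. by exists (fun R x => sval x). Defined.

Definition cores (X Y : zfunctor) (Z : subfunctor Y) (f : mor X Y)
  (fZ : forall (R : comPzRingType) (x : X R), Z R (f R x)) : mor X (sub Z).
Proof.
exists (fun R x => exist _ (f R x) (fZ R x)) => R S h x.
by apply: eq_exist; rewrite mor_nat.
Defined.

Definition pullback (X Y : zfunctor) (f : mor X Y) (Z : subfunctor Y) : subfunctor X.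
Proof.
exists (fun R x => Z R (f R x)) => R S h x.
by rewrite mor_nat; apply: sf_map.
Defined.

Definition andsub (X : zfunctor) (Z W : subfunctor X) : subfunctor X.
Proof.
exists (fun R x => Z R x /\ W R x) => R S h x [Zx Wx].
by split; apply: sf_map.
Defined.

Definition fst_mor (X Y : zfunctor) : mor (prodf X Y) X.
Proof. by exists (fun R x => x.1). Defined.

Definition snd_mor (X Y : zfunctor) : mor (prodf X Y) Y.
Proof. by exists (fun R x => x.2). Defined.

Definition prod_mor (X X' Y Y' : zfunctor) (f : mor X X') (g : mor Y Y') :
  mor (prodf X Y) (prodf X' Y').
Proof.
exists (fun R x => (f R x.1, g R x.2)) => R S h x.
by rewrite /= !mor_nat.
Defined.

Lemma iso_intro (X Y : zfunctor) (f : mor X Y) :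
  (forall R, injective (@mor_fun X Y f R)) ->
  (forall R y, exists x, f R x = y) -> isomorphic X Y.
Proof. by move=> fI fS; exists f => R; apply: inj_surj_bij. Qed.

Lemma iso_cancel (X Y : zfunctor) (f : mor X Y)
    (g : forall R : comPzRingType, Y R -> X R) :
  (forall R, cancel (@mor_fun X Y f R) (g R)) ->
  (forall R, cancel (g R) (@mor_fun X Y f R)) -> isomorphic X Y.
Proof. by move=> fK gK; exists f => R; exists (g R). Qed.

Lemma iso_refl X : isomorphic X X.
Proof. by exists (mor_id X) => R; exists id. Qed.

Lemma iso_sym X Y : isomorphic X Y -> isomorphic Y X.
Proof.
case=> f fB; pose g R y := sval (cid (bij_surj (fB R) y)).
have gK R y : f R (g R y) = y by rewrite /g; case: cid.
have fI R : injective (@mor_fun _ _ f R) by apply: bij_inj (fB R).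
have gN (R S : comPzRingType) (h : {rmorphism R -> S}) y : g S (fmap Y h y) = fmap X h (g R y).
  by apply: fI; rewrite gK mor_nat gK.
by exists (Mor gN) => R; exists (@mor_fun _ _ f R) => x //=; apply: fI.
Qed.

Lemma iso_trans X Y Z : isomorphic X Y -> isomorphic Y Z -> isomorphic X Z.
Proof.
by case=> f fB [g gB]; exists (mor_comp g f) => R; apply: bij_comp.
Qed.

Lemma iso_prod X X' Y Y' :
  isomorphic X X' -> isomorphic Y Y' -> isomorphic (prodf X Y) (prodf X' Y').
Proof.
case=> f fB [g gB]; exists (prod_mor f g) => R.
have [f' fK f'K] := fB R; have [g' gK g'K] := gB R.
by exists (fun x => (f' x.1, g' x.2)) => [] [x y] /=; rewrite ?fK ?gK ?f'K ?g'K.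
Qed.

Lemma iso_sub (X Y : zfunctor) (f : mor X Y) (Z : subfunctor X) (W : subfunctor Y) :
  (forall R, bijective (@mor_fun X Y f R)) ->
  (forall R x, Z R x <-> W R (f R x)) -> isomorphic (sub Z) (sub W).
Proof.
move=> fB ZW; have fZ R (x : sub Z R) : W R (f R (sval x)).
  by apply/ZW/svalP.
apply: (@iso_intro _ _ (@cores (sub Z) Y W (mor_comp f (incl Z)) fZ)).
  by move=> R x y [] /(bij_inj (fB R)) /sval_inj_prop.
move=> R [y Wy]; have [g fK gK] := fB R.
have Zx : Z R (g y) by apply/ZW; rewrite gK.
by exists (exist _ _ Zx); apply: eq_exist => /=.
Qed.

Lemma iso_sub_eq (X : zfunctor) (Z W : subfunctor X) :
  (forall R x, Z R x <-> W R x) -> isomorphic (sub Z) (sub W).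
Proof.
by apply: (@iso_sub _ _ (mor_id X)) => R; exists id.
Qed.

Lemma iso_sub_full (X : zfunctor) (Z : subfunctor X) :
  (forall R x, Z R x) -> isomorphic (sub Z) X.
Proof.
move=> ZT; apply: (@iso_intro _ _ (incl Z)) => [R|R y].
  exact: sval_inj_prop.
by exists (exist _ y (ZT R y)).
Qed.

Lemma iso_sub_sub (X : zfunctor) (Z : subfunctor X) (W : subfunctor (sub Z))
    (V : subfunctor X) :
  (forall R x, V R x <-> exists Zx : Z R x, W R (exist _ x Zx)) ->
  isomorphic (sub W) (sub V).
Proof.
move=> VP; have h R (x : sub W R) : V R (sval (sval x)).
  by case: x => [[x Zx] Wx]; apply/VP; exists Zx.
apply: (@iso_intro _ _ (@cores (sub W) X V (mor_comp (incl Z) (incl W)) h)).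
  by move=> R x y [] /sval_inj_prop /sval_inj_prop.
move=> R [x Vx]; have [Zx Wx] := (VP R x).1 Vx.
by exists (exist _ (exist _ x Zx) Wx); apply: eq_exist.
Qed.

Lemma iso_prod_sub (X Y : zfunctor) (Z : subfunctor Y) :
  isomorphic (prodf X (sub Z)) (sub (pullback (snd_mor X Y) Z)).
Proof.
have h R (x : prodf X (sub Z) R) : pullback (snd_mor X Y) Z R (x.1, sval x.2).
  exact: svalP x.2.
exists (cores (f := prod_mor (mor_id X) (incl Z)) h).
move=> R; exists (fun x => ((sval x).1, exist (Z R) (sval x).2 (svalP x))) => [[x [y Zy]]|[[x y] Zy]].
  by congr pair; apply: eq_exist.
by apply: eq_exist.
Qed.

(** * Closed and locally closed subfunctors *)

Lemma closedP (X : zfunctor) (Z : subfunctor X) : is_closed Z <->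
  forall (A : comPzRingType) (x : X A), exists I : A -> Prop,
  forall (R : comPzRingType) (f : {rmorphism A -> R}),
    Z R (fmap X f x) <-> forall a, I a -> f a = 0.
Proof. by split=> [h A x|h A x _]; apply: h. Qed.

Lemma closed_pullback (X Y : zfunctor) (f : mor X Y) (Z : subfunctor Y) :
  is_closed Z -> is_closed (pullback f Z).
Proof.
move=> /closedP Zc; apply/closedP => A x; have [I IP] := Zc A (f A x).
by exists I => R g; rewrite -IP /= mor_nat.
Qed.

Lemma closed_and (X : zfunctor) (Z W : subfunctor X) :
  is_closed Z -> is_closed W -> is_closed (andsub Z W).
Proof.
move=> /closedP Zc /closedP Wc; apply/closedP => A x.
have [I IP] := Zc A x; have [J JP] := Wc A x.
exists (fun a => I a \/ J a) => R f; split=> [[/IP fI /JP fJ] a []|h].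
- exact: fI.
- exact: fJ.
by split; [apply/IP|apply/JP] => a ?; apply: h; [left|right].
Qed.

Definition eqsub (X : zfunctor) (p q : nat) (f g : mor X (Mat p q)) : subfunctor X.
Proof.
exists (fun R x => f R x = g R x) => R S h x e.
by rewrite !mor_nat e.
Defined.

Lemma closed_eq (X : zfunctor) (p q : nat) (f g : mor X (Mat p q)) :
  is_closed (eqsub f g).
Proof.
apply/closedP => A x.
exists (fun a => exists i j, a = (f A x : 'M_(p, q)) i j - (g A x : 'M_(p, q)) i j) => R h.
rewrite /= !mor_nat; split=> [/matrixP e a [i [j ->]]|e].
  by have := e i j; rewrite !mxE rmorphB => ->; rewrite subrr.
by apply/matrixP => i j; rewrite !mxE; apply/subr0_eq; rewrite -rmorphB; apply: e; exists i, j.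
Qed.

(** Open subfunctors are defined by partitions of unity; treating the number
[1] as one element [y] among others gives the condition the closure properties of
an ideal. *)
Definition in_span (A R : comPzRingType) (I : A -> Prop) (f : {rmorphism A -> R}) (y : R) :=
  exists (n : nat) (a : 'I_n -> A) (c : 'I_n -> R),
    (forall i, I (a i)) /\ \sum_(i < n) c i * f (a i) = y.

Section UnitSpan.
Variables (A R : comPzRingType) (f : {rmorphism A -> R}).

Lemma in_span_gen (I : A -> Prop) a c : I a -> in_span I f (c * f a).
Proof. by move=> Ia; exists 1%N, (fun=> a), (fun=> c); rewrite big_ord1. Qed.

Lemma in_span_mul (I : A -> Prop) y z :
  in_span I f y -> in_span I f (z * y).
Proof.
case=> n [a [c [Ia <-]]]; exists n, a, (fun i => z * c i); split=> //.
by rewrite mulr_sumr; apply: eq_bigr => i _; rewrite mulrA.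
Qed.

Lemma in_span_add (I : A -> Prop) y z :
  in_span I f y -> in_span I f z -> in_span I f (y + z).
Proof.
case=> n [a [c [Ia <-]]] [m [b [d [Ib <-]]]].
exists (n + m)%N, (fun i => match split i with inl j => a j | inr j => b j end),
  (fun i => match split i with inl j => c j | inr j => d j end); split.
  by move=> i; case: split.
rewrite big_split_ord /=; congr (_ + _); apply: eq_bigr => i _.
  by rewrite (unsplitK (inl i)).
by rewrite (unsplitK (inr i)).
Qed.

Lemma in_span_zero (I : A -> Prop) : in_span I f 0.
Proof.
by exists 0%N, (fun=> 0), (fun=> 0); rewrite big_ord0; split=> // [[]].
Qed.

Lemma in_span_sub (I J : A -> Prop) y :
  in_span I f y -> (forall a, I a -> in_span J f (f a)) -> in_span J f y.
Proof.
move=> [n [a [c [Ia <-]]]] IJ; elim/big_ind: _ => [||i _].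
- exact: in_span_zero.
- exact: in_span_add.
- exact/in_span_mul/IJ.
Qed.

End UnitSpan.

Lemma openP (X : zfunctor) (U : subfunctor X) : is_open U <->
  forall (A : comPzRingType) (x : X A), exists I : A -> Prop,
  forall (R : comPzRingType) (f : {rmorphism A -> R}),
    U R (fmap X f x) <-> in_span I f 1.
Proof. by []. Qed.

Lemma open_full (X : zfunctor) : is_open (full_sub X).
Proof.
move=> A x; exists (fun=> True) => R f; split=> // _.
by have := @in_span_gen A R f (fun=> True) 1 1 Logic.I; rewrite rmorph1 mulr1.
Qed.

Lemma open_pullback (X Y : zfunctor) (f : mor X Y) (Z : subfunctor Y) :
  is_open Z -> is_open (pullback f Z).
Proof.
move=> Zc A x; have [I IP] := Zc A (f A x).
by exists I => R g; rewrite -IP /= mor_nat.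
Qed.

(** [D(I)] and [D(J)] meet in [D(IJ)]: multiply the two partitions of unity. *)
Lemma open_and (X : zfunctor) (Z W : subfunctor X) :
  is_open Z -> is_open W -> is_open (andsub Z W).
Proof.
move=> Zo Wo; apply/openP => A x; have [I IP] := Zo A x; have [J JP] := Wo A x.
pose K a := exists i j, [/\ I i, J j & a = i * j].
exists K => R f.
split=> [[/IP hI /JP [n [b [d [Jb dE]]]]]|h].
  apply: (@in_span_sub A R f I K 1 hI) => a Ia.
  rewrite -[f a]mulr1 -dE mulr_sumr.
  elim/big_ind: _ => [||i _].
  - exact: in_span_zero.
  - exact: in_span_add.
  - rewrite mulrCA -rmorphM; apply: in_span_gen.
    by exists a, (b i).
split; [apply/IP; apply: (@in_span_sub A R f K I 1 h)|apply/JP; apply: (@in_span_sub A R f K J 1 h)] => _ [i [j [Ii Jj ->]]].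
  by rewrite mulrC rmorphM; apply: in_span_gen.
by rewrite rmorphM; apply: in_span_gen.
Qed.

Definition unit_sub (n : nat) (j : 'I_n) : subfunctor (Aff n).
Proof.
exists (fun (R : comPzRingType) (v : 'rV[R]_n) => exists y, v 0 j * y = 1) => R S f v [y vy].
by exists (f y); rewrite mxE -rmorphM vy rmorph1.
Defined.

Lemma open_unit (n : nat) (j : 'I_n) : is_open (unit_sub j).
Proof.
apply/openP => A v; exists (fun a => a = (v : 'rV_n) 0 j) => R f; split=> [[y]|].
  by rewrite mxE mulrC => <-; apply: in_span_gen.
case=> n' [a [c [aE cE]]]; exists (\sum_i c i).
by rewrite mxE mulr_sumr -cE; apply: eq_bigr => i _; rewrite aE mulrC.
Qed.

Definition zero_sub (n : nat) (P : pred 'I_n) : subfunctor (Aff n).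
Proof.
exists (fun (R : comPzRingType) (v : 'rV[R]_n) => forall j, P j -> v 0 j = 0) => R S f v h j Pj.
by rewrite mxE h // rmorph0.
Defined.

Lemma closed_zero (n : nat) (P : pred 'I_n) : is_closed (zero_sub P).
Proof.
apply/closedP => A v; exists (fun a => exists j, P j /\ a = (v : 'rV_n) 0 j).
move=> R f; split=> [h _ [j [Pj ->]]|h j Pj].
  by have := h j Pj; rewrite mxE.
by rewrite mxE; apply: h; exists j.
Qed.

Lemma lc_closed_open (X : zfunctor) (Z U : subfunctor X) :
  is_closed Z -> is_open U -> is_locally_closed (andsub Z U).
Proof.
move=> /closedP Zc Uo; exists U; split=> // [R x []|A x Ux] //.
have [I IP] := Zc A x; exists I => R f; rewrite -IP; split=> [[]|] //.
by split=> //; apply: sf_map.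
Qed.

Lemma lc_closed (X : zfunctor) (Z : subfunctor X) :
  is_closed Z -> is_locally_closed Z.
Proof. by move=> Zc; exists (full_sub X); split=> //; apply: open_full. Qed.

Lemma lc_pullback (X Y : zfunctor) (f : mor X Y) (Z : subfunctor Y) :
  is_locally_closed Z -> is_locally_closed (pullback f Z).
Proof.
case=> U [Uo ZU Zc]; exists (pullback f U); split=> [|R x|A x Ux].
- exact: open_pullback.
- exact: ZU.
have [I IP] := Zc A (f A x) Ux.
by exists I => R g; rewrite -IP /= mor_nat.
Qed.

Lemma lc_and (X : zfunctor) (Z W : subfunctor X) :
  is_locally_closed Z -> is_locally_closed W -> is_locally_closed (andsub Z W).
Proof.
case=> U [Uo ZU Zc] [V [Vo WV Wc]]; exists (andsub U V); split.
- exact: open_and.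
- by move=> R x [/ZU ? /WV].
move=> A x [/Zc[I IP] /Wc[J JP]].
exists (fun a => I a \/ J a) => R f; split=> [[/IP fI /JP fJ] a []|h].
- exact: fI.
- exact: fJ.
by split; [apply/IP|apply/JP] => a ?; apply: h; [left|right].
Qed.

(** * Affine varieties *)

(** Formal polynomials over [Z]; they take values in all test rings, including
the zero ring. *)
Inductive term (n : nat) : Type :=
| tvar of 'I_n
| tzero
| tone
| topp of term n
| tadd of term n & term n
| tmul of term n & term n.
Arguments tzero {n}.
Arguments tone {n}.

Fixpoint teval (n : nat) (R : comPzRingType) (v : 'rV[R]_n) (t : term n) : R :=
  match t with
  | tvar j => v 0 j
  | tzero => 0
  | tone => 1
  | topp t => - teval v t
  | tadd s t => teval v s + teval v t
  | tmul s t => teval v s * teval v t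
  end.

Lemma teval_map (n : nat) (R S : comPzRingType) (f : {rmorphism R -> S})
    (v : 'rV[R]_n) (t : term n) : teval (map_mx f v) t = f (teval v t).
Proof.
elim: t => /= [j||||s -> t ->|s -> t ->]; first by rewrite mxE.
- by rewrite rmorph0.
- by rewrite rmorph1.
- by move=> t ->; rewrite rmorphN.
- by rewrite rmorphD.
- by rewrite rmorphM.
Qed.

Section CoordinateRing.
Variables (n : nat) (Z : subfunctor (Aff n)).

(** Identifying terms that agree on all points of [Z] gives at once the quotient
of the polynomial ring by all equations valid on [Z]. *)
Definition coord_congruence : ring_congruence.
Proof.
apply: (@RingCongruence (term n)
  (fun s t => forall (R : comPzRingType) (v : Aff n R), Z R v -> teval v s = teval v t)
  tzero tone (@topp n) (@tadd n) (@tmul n)) => //=.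
- by move=> x y xy R v Zv; rewrite xy.
- by move=> x y z xy yz R v Zv; rewrite xy // yz.
- by move=> x y xy R v Zv; rewrite xy.
- by move=> x x' y y' xx yy R v Zv; rewrite xx ?yy.
- by move=> x x' y y' xx yy R v Zv; rewrite xx ?yy.
- by move=> x y z R v _; rewrite addrA.
- by move=> x y R v _; rewrite addrC.
- by move=> x R v _; rewrite add0r.
- by move=> x R v _; rewrite addNr.
- by move=> x y z R v _; rewrite mulrA.
- by move=> x y R v _; rewrite mulrC.
- by move=> x R v _; rewrite mul1r.
- by move=> x y z R v _; rewrite mulrDl.
Defined.

Definition coord : comPzRingType := cquot coord_congruence.

Definition cclass (t : term n) : coord := @cpi coord_congruence t.

Lemma cclassP s t : cclass s = cclass t <->
  forall (R : comPzRingType) (v : Aff n R), Z R v -> teval v s = teval v t.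
Proof. exact: cpiP. Qed.

Lemma cclass_surj (q : coord) : exists t, cclass t = q.
Proof. by exists (crepr q); apply: creprK. Qed.

Definition generic_point : Aff n coord := \row_j cclass (tvar j).

(** A term evaluated at the tuple of the classes of the variables is its own
class; thus every statement about classes is one about points. *)
Lemma teval_generic t : teval (generic_point : 'rV_n) t = cclass t.
Proof.
elim: t => //= [j|t ->|s -> t ->|s -> t ->]; first by rewrite mxE.
- by rewrite /cclass (@cpiN coord_congruence).
- by rewrite /cclass (@cpiD coord_congruence).
- by rewrite /cclass (@cpiM coord_congruence).
Qed.

Lemma coord_eval (R : comPzRingType) (v : Aff n R) : Z R v ->
  exists h : {rmorphism coord -> R}, forall t, h (cclass t) = teval v t.
Proof.
move=> Zv; pose h (q : coord) : R := teval v (crepr q).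
have hE t : h (cclass t) = teval v t.
  by apply: (cclassP _ _).1 Zv; apply: creprK.
have hz : zmod_morphism h.
  move=> p q; have [s <-] := cclass_surj p; have [t <-] := cclass_surj q.
  have -> : cclass s - cclass t = cclass (tadd s (topp t)).
    by rewrite -!teval_generic.
  by rewrite !hE.
have hm : GRing.monoid_morphism h.
  split=> [|p q]; first exact: (hE tone).
  have [s <-] := cclass_surj p; have [t <-] := cclass_surj q.
  have -> : cclass s * cclass t = cclass (tmul s t) by rewrite -!teval_generic.
  by rewrite !hE.
pose z := GRing.isZmodMorphism.Build coord R h hz.
pose m := GRing.isMonoidMorphism.Build coord R h hm.
pose g : {rmorphism coord -> R} := HB.pack h z m.
by exists g.
Qed.

Lemma coord_hom_eq (R : comPzRingType) (g h : {rmorphism coord -> R}) :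
  fmap (Aff n) g generic_point = fmap (Aff n) h generic_point -> g = h.
Proof.
move=> /= gh; apply: rmorph_ext => q; have [t <-] := cclass_surj q.
by rewrite -teval_generic -!teval_map gh.
Qed.

Lemma coord_fg : finitely_generated coord.
Proof.
exists n, (fun j => cclass (tvar j)) => P Pv P1 PB PM q.
have [t <-] := cclass_surj q; rewrite -teval_generic.
have P0 : P 0 by rewrite -(subrr 1); apply: PB.
elim: t => //= [j|t Pt|s Ps t Pt|s Ps t Pt]; first by rewrite mxE.
- by rewrite -sub0r; apply: PB.
- by rewrite -[teval _ t]opprK; apply/PB => //; rewrite -sub0r; apply: PB.
- exact: PM.
Qed.

End CoordinateRing.

Lemma full_coord_hom (n : nat) (R : comPzRingType) (v : Aff n R) :
  exists h : {rmorphism coord (full_sub (Aff n)) -> R},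
    fmap (Aff n) h (generic_point (full_sub (Aff n))) = v.
Proof.
have [h hE] := @coord_eval n (full_sub (Aff n)) R v Logic.I.
by exists h; apply/rowP => j; rewrite !mxE hE.
Qed.

(** A closed [Z] is cut out by equations at the generic point of affine space,
so its own generic point, where these equations hold, lies on [Z]. *)
Lemma generic_point_closed (n : nat) (Z : subfunctor (Aff n)) :
  is_closed Z -> Z (coord Z) (generic_point Z).
Proof.
move=> /closedP /(_ _ (generic_point (full_sub _)))[I IP].
have [h hE] := full_coord_hom (generic_point Z).
rewrite -hE; apply/IP => p Ip.
have [t tp] := cclass_surj p.
have -> : h p = cclass Z t.
  by rewrite -tp -!teval_generic -teval_map -hE.
apply: ((cclassP Z t tzero).2) => R v Zv /=.
have [g gE] := full_coord_hom v; rewrite -gE in Zv *.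
by rewrite teval_map teval_generic tp; apply: (IP _ _).1 Zv _ Ip.
Qed.

(** Affine of finite type over [Z], presented by equations: this form passes to
subfunctors and products without any construction on rings, whereas a product of
spectra calls for a tensor product. *)
Definition is_affine (X : zfunctor) : Prop :=
  exists (n : nat) (f : mor X (Aff n)), is_closed_immersion f.

(** The glued coordinates of compatible local points satisfy the equations of the
image, because these hold locally; and [X] is itself an affine chart, the
spectrum of the coordinate ring of its image. *)
Lemma affine_variety X : is_affine X -> is_variety X.
Proof.
case=> n [f [Z [Zc imf]]]; have /closedP Zc' := Zc.
have fI R : injective (@mor_fun _ _ f R) by have [] := imf R.
have fZ R v : Z R v <-> exists x, f R x = v by have [_] := imf R; apply.
split.
- move=> R m r c Rl phi Rll p q rc loc pq loc2 x xpq.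
  have gl := @glue R m r c Rl phi Rll p q rc loc pq loc2.
  have [y yP] : exists y : 'I_n -> R, forall j i, phi i (y j) = (f _ (x i) : 'rV_n) 0 j.
    suff h j : exists y, forall i, phi i y = (f _ (x i) : 'rV_n) 0 j.
      by exists (fun j => sval (cid (h j))) => j; case: cid.
    have [|y [yE _]] := gl (fun i => (f _ (x i) : 'rV_n) 0 j); last by exists y.
    move=> i k; have /(congr1 (fun z => (f _ z : 'rV_n) 0 j)) := xpq i k.
    by rewrite !mor_nat !mxE.
  have yE i : fmap (Aff n) (phi i) (\row_j y j) = f _ (x i).
    by apply/rowP => j; rewrite !mxE yP.
  (* Elements are determined locally: glue the zero section. *)
  have zero a : (forall i, phi i a = 0) -> a = 0.
    move=> a0; have [|z [_ zU]] := gl (fun=> 0).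
      by move=> i j; rewrite !rmorph0.
    by rewrite -(zU a a0); apply: zU => i; rewrite rmorph0.
  have : Z R (\row_j y j).
    have [I IP] := Zc' R (\row_j y j).
    rewrite -[X in Z R X](@fmap_id (Aff n)); apply/IP => a Ia; apply: zero => i.
    by move: a Ia; apply/IP; rewrite yE; apply/fZ; exists (x i).
  case/fZ => z zE; exists z; split=> [i|z' z'E].
    by apply: fI; rewrite mor_nat zE.
  apply: fI; rewrite zE; apply/rowP => j; rewrite mxE.
  apply/subr0_eq/zero => i; rewrite rmorphB yP -z'E mor_nat mxE.
  exact: subrr.
- move=> A x y; exists (fun a => exists j, a = (f A x : 'rV_n) 0 j - (f A y : 'rV_n) 0 j).
  move=> R h; split=> [/(congr1 (@mor_fun _ _ f R))|e].
    by rewrite !mor_nat => /rowP e a [j ->]; have := e j; rewrite !mxE rmorphB => ->; apply: subrr.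
  apply: fI; rewrite !mor_nat; apply/rowP => j; rewrite !mxE.
  by apply/subr0_eq; rewrite -rmorphB; apply: e; exists j.
exists 1%N, (fun=> full_sub X), (fun=> coord Z).
split; [by move=> i; apply: open_full|move=> i|by exists 0].
split; first exact: coord_fg.
apply: (@iso_trans _ X); first exact: iso_sub_full.
apply: iso_sym.
have Zu := generic_point_closed Zc.
have [x0 x0E] := (fZ _ _).1 Zu.
have gN (R S : comPzRingType) (g : {rmorphism R -> S}) (h : Spec (coord Z) R) :
    fmap X (g \o h) x0 = fmap X g (fmap X h x0) by rewrite fmap_comp.
apply: (@iso_intro (Spec (coord Z)) X (Mor gN)) => [R g h /= e|R x].
  by apply: coord_hom_eq; rewrite -x0E -!mor_nat e.
have Zx : Z R (f R x) by apply/fZ; exists x.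
have [h hE] := coord_eval Zx.
exists h; apply: fI; rewrite /= mor_nat x0E; apply/rowP => j.
by rewrite !mxE hE.
Qed.

Lemma affine_Aff n : is_affine (Aff n).
Proof.
exists n, (mor_id _), (full_sub _); split.
  by apply/closedP => A x; exists (fun=> False).
by move=> R; split=> // x; split=> // _; exists x.
Qed.

Lemma affine_iso X Y : isomorphic X Y -> is_affine Y -> is_affine X.
Proof.
case=> g gB [n [f [Z [Zc imf]]]]; exists n, (mor_comp f g), Z; split=> // R.
have [fI fZ] := imf R; split=> [x y /= /fI /(bij_inj (gB R))//|v].
rewrite fZ; split=> [[y <-]|[x <-]]; last by exists (g R x).
by have [x <-] := bij_surj (gB R) y; exists x.
Qed.

(** The equations of [C] live on [X], not on the affine space: they become available
modulo the equations [I] of [X], and are then lifted along the quotient map. *)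
Lemma affine_closed_sub X (C : subfunctor X) : is_affine X -> is_closed C -> is_affine (sub C).
Proof.
case=> n [f [Z [/closedP Zc imf]]] /closedP Cc.
have fI R : injective (@mor_fun _ _ f R) by have [] := imf R.
have fZ R v : Z R v <-> exists x, f R x = v by have [_] := imf R; apply.
have Wm (R S : comPzRingType) (h : {rmorphism R -> S}) (v : Aff n R) :
    (exists x, C R x /\ f R x = v) -> exists x, C S x /\ f S x = fmap (Aff n) h v.
  by case=> x [Cx <-]; exists (fmap X h x); rewrite mor_nat; split=> //; apply: sf_map.
exists n, (mor_comp f (incl C)), (SubFunctor Wm); split; last first.
  move=> R; split=> [x y /= /fI /sval_inj_prop//|v]; split=> [[x [Cx <-]]|[[x Cx] <-]].
    by exists (exist _ x Cx).
  by exists x.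
apply/closedP => A v; have [I IP] := Zc A v.
pose J := ideal_span I.
have [x xE] : exists x, f _ x = fmap (Aff n) (qpi J) v.
  apply/fZ/IP => a Ia; apply/qpi_eq0.
  exact: ideal_span_gen.
have [I' IP'] := Cc _ x.
exists (fun a => I a \/ I' (qpi J a)) => R g.
have key : (forall a, I a -> g a = 0) ->
    exists2 g' : {rmorphism quot J -> R}, g' \o qpi J = g :> {rmorphism A -> R}
      & f _ (fmap X g' x) = fmap (Aff n) g v.
  move=> gI; have [|g' g'E] := @quot_factor A J R g.
    by move=> a Ja; apply: Ja.
  by exists g' => //; rewrite mor_nat xE -fmap_comp g'E.
split=> [[y [Cy yE]]|gI].
  have gI : forall a, I a -> g a = 0 by apply/IP/fZ; exists y.
  have [g' g'E fE] := key gI.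
  move=> a [/gI//|Ia]; rewrite -g'E /=; move: (qpi J a) Ia.
  by apply/IP'; rewrite (_ : fmap X g' x = y) //; apply: fI; rewrite fE.
have [|g' g'E fE] := key _; first by move=> a Ia; apply: gI; left.
exists (fmap X g' x); split=> //; apply/IP' => b Ib.
rewrite -(qreprK b); have /(congr1 (fun h : {rmorphism A -> R} => h (qrepr b))) /= -> := g'E.
by apply: gI; right; rewrite qreprK.
Qed.

Lemma closed_immersion_iso X Y (f : mor X Y) (Z : subfunctor Y) :
  image_is f Z -> isomorphic X (sub Z).
Proof.
move=> imf; have h R x : Z R (f R x) by have [_ ->] := imf R; exists x.
apply: (@iso_intro _ _ (cores h)) => R; have [fI fZ] := imf R.
  by move=> x y [] /fI.
by move=> [y Zy]; have [x xE] := (fZ y).1 Zy; exists x; apply: eq_exist.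
Qed.

Lemma affine_closed_immersion X Y (f : mor X Y) :
  is_affine Y -> is_closed_immersion f -> is_affine X.
Proof.
move=> eY [Z [Zc /closed_immersion_iso XZ]]; apply: affine_iso XZ _.
exact: affine_closed_sub.
Qed.

Lemma iso_Aff_prod m n : isomorphic (prodf (Aff m) (Aff n)) (Aff (m + n)).
Proof.
have h (R S : comPzRingType) (f : {rmorphism R -> S}) (x : prodf (Aff m) (Aff n) R) :
    row_mx (map_mx f x.1) (map_mx f x.2) = map_mx f (row_mx x.1 x.2).
  by rewrite map_row_mx.
apply: (@iso_cancel _ _ (@Mor (prodf (Aff m) (Aff n)) (Aff (m + n))
  (fun R x => row_mx x.1 x.2) h)
  (fun R (v : 'rV_(m + n)) => (lsubmx v, rsubmx v))) => R.
  by move=> [x y] /=; rewrite row_mxKl row_mxKr.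
by move=> v; rewrite /= hsubmxK.
Qed.

Lemma iso_Mat_Aff m n : isomorphic (Mat m n) (Aff (m * n)).
Proof.
have h (R S : comPzRingType) (f : {rmorphism R -> S}) (x : Mat m n R) :
    mxvec (map_mx f x) = map_mx f (mxvec x) by rewrite map_mxvec.
apply: (@iso_cancel _ _ (@Mor (Mat m n) (Aff (m * n)) (fun R => @mxvec R m n) h)
  (fun R => @vec_mx R m n)) => R x /=; first exact: mxvecK.
exact: vec_mxK.
Qed.

Lemma affine_Mat m n : is_affine (Mat m n).
Proof. by apply: affine_iso (iso_Mat_Aff m n) _; apply: affine_Aff. Qed.

Lemma prod_closed_immersion X X' Y Y' (f : mor X X') (g : mor Y Y') :
  is_closed_immersion f -> is_closed_immersion g ->
  is_closed_immersion (prod_mor f g).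
Proof.
move=> [Z [Zc imf]] [W [Wc img]].
exists (andsub (pullback (fst_mor _ _) Z) (pullback (snd_mor _ _) W)); split.
  by apply: closed_and; apply: closed_pullback.
move=> R; have [fI fZ] := imf R; have [gI gW] := img R; split.
  by move=> [x y] [x' y'] [/fI-> /gI->].
move=> [x y] /=; rewrite fZ gW; split=> [[[x' <-] [y' <-]]|[[x' y'] /= [<- <-]]].
  by exists (x', y').
by split; [exists x'|exists y'].
Qed.

Lemma affine_prod X Y : is_affine X -> is_affine Y -> is_affine (prodf X Y).
Proof.
move=> [m [f fc]] [n [g gc]].
apply: affine_closed_immersion (prod_closed_immersion fc gc).
by apply: affine_iso (iso_Aff_prod m n) _; apply: affine_Aff.
Qed.

(** Rabinowitsch's trick: adjoin the inverse [y] of the function, subject to the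
closed condition [f_j y = 1]. *)
Lemma affine_unit_locus X n (f : mor X (Aff n)) (j : 'I_n) :
  is_affine X -> is_affine (sub (pullback f (unit_sub j))).
Proof.
move=> eX.
have Wm (R S : comPzRingType) (h : {rmorphism R -> S}) (x : prodf X (Aff 1) R) :
    (f R x.1 : 'rV_n) 0 j * (x.2 : 'rV_1) 0 0 = 1 ->
    (f S (fmap X h x.1) : 'rV_n) 0 j * (map_mx h x.2 : 'rV_1) 0 0 = 1.
  by move=> e; rewrite mor_nat !mxE -rmorphM e rmorph1.
pose W := @SubFunctor (prodf X (Aff 1)) _ Wm.
have Wc : is_closed W.
  apply/closedP => A x.
  exists (fun a => a = (f A x.1 : 'rV_n) 0 j * (x.2 : 'rV_1) 0 0 - 1) => R h.
  rewrite /= mor_nat !mxE -rmorphM; split=> [e _ ->|e].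
    by rewrite rmorphB e rmorph1 subrr.
  by apply/subr0_eq; rewrite -(rmorph1 h) -rmorphB; apply: e.
suff i : isomorphic (sub W) (sub (pullback f (unit_sub j))).
  apply: affine_iso (iso_sym i) _; apply: affine_closed_sub => //.
  by apply: affine_prod => //; apply: affine_Aff.
have h R (x : sub W R) : pullback f (unit_sub j) R (sval x).1.
  by case: x => [[x y] /= e]; exists ((y : 'rV_1) 0 0).
apply: (@iso_intro _ _ (@cores (sub W) X _ (mor_comp (fst_mor _ _) (incl W)) h)) => R.
  move=> [[x y] /= e] [[x' y'] /= e'] [/= xx]; subst x'; apply: eq_exist.
  congr pair; apply/rowP => k; rewrite ord1.
  by rewrite -[LHS]mulr1 -e' mulrCA mulrA e mul1r.
move=> [x [y xy]].
have e : W R (x, \row__ y) by rewrite /= mxE.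
by exists (exist _ _ e); apply: eq_exist.
Qed.

(** By the adjugate, [GL_m] is the locus in the space of matrices where a single
function, the determinant, is invertible. *)
Lemma GL_sub_det (m : nat) (R : comPzRingType) (A : 'M[R]_m) :
  GL_sub m R A <-> exists y, \det A * y = 1.
Proof.
split=> [[B [AB _]]|[y yA]].
  by exists (\det B); rewrite -det_mulmx AB det1.
exists (y *: \adj A); rewrite -scalemxAl -scalemxAr mul_mx_adj mul_adj_mx.
by rewrite scale_scalar_mx mulrC yA.
Qed.

Lemma affine_GL m : is_affine (GL m).
Proof.
have h (R S : comPzRingType) (f : {rmorphism R -> S}) (A : 'M[R]_m) :
    \row__ \det (map_mx f A) = map_mx f (\row__ \det A) :> 'rV_1.
  by apply/rowP => j; rewrite !mxE det_map_mx.
pose d := @Mor (Mat m m) (Aff 1) (fun R (A : 'M_m) => \row__ \det A) h.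
apply: affine_iso (affine_unit_locus d ord0 (affine_Mat m m)).
apply: iso_sub_eq => R A; rewrite [X in X <-> _]GL_sub_det /=.
by split=> -[y]; [exists y; rewrite mxE|rewrite mxE; exists y].
Qed.

(** * Coproducts *)

(** What the sheaf condition for the empty cover says. *)
Definition zero_pt (X : zfunctor) : Prop :=
  forall R : comPzRingType, 1 = 0 :> R ->
    (exists x : X R, True) /\ (forall x y : X R, x = y).

Lemma trivial_ring (R : comPzRingType) : 1 = 0 :> R -> forall x y : R, x = y.
Proof. by move=> e x y; rewrite -[x]mul1r -[y]mul1r e !mul0r. Qed.

Lemma affine_zero_pt X : is_affine X -> zero_pt X.
Proof.
case=> n [f [Z [/closedP Zc imf]]] R e; have [fI fZ] := imf R; split.
  have [I IP] := Zc R (0 : 'rV_n).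
  have : Z R (fmap (Aff n) idfun (0 : 'rV_n)).
    by apply/IP => a _; apply: trivial_ring.
  by case/fZ => x _; exists x.
by move=> x y; apply: fI; apply/rowP => j; apply: trivial_ring.
Qed.

(** Multiply [sum_j e_j = 1] by [e_i]. *)
Lemma cp_mulee N X (R : comPzRingType) (x : coprod N X R) i :
  cp_idem x i * cp_idem x i = cp_idem x i.
Proof.
have [iN|/(cp_out x) ->] := ltnP i N; last by rewrite mul0r.
rewrite -[RHS]mulr1 -(cp_sum x) (bigD1 (Ordinal iN)) //= mulrDr mulr_sumr.
rewrite big1 ?addr0 // => j ij; apply: cp_orth.
by apply: contra ij => /eqP e; apply/eqP/val_inj.
Qed.

Lemma coprod_ext N X (R : comPzRingType) (x y : coprod N X R) :
  (forall i, cp_idem x i = cp_idem y i) ->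
  (forall i (T : comPzRingType) (f : Spec R T) hx hy,
     cp_mor x i T (exist (Dopen (cp_idem x i) T) f hx)
     = cp_mor y i T (exist (Dopen (cp_idem y i) T) f hy)) -> x = y.
Proof.
case: x y => e u o1 o2 s [e' u' o1' o2' s'] /= ee; have {}ee : e = e' by apply/funext.
subst e' => uu; apply: coprod_pts_ext => i; apply: mor_ext => T [f h].
exact: uu.
Qed.

Section AtPoint.
Variables (N : nat) (X : nat -> zfunctor).

(** Where [e_i = 1], the open [D(e_i)] is everything, and the identity is a point of
it: evaluating there gives the point of [X_i] that [x] is. *)
Definition at_pt (R : comPzRingType) (x : coprod N X R) i (h : cp_idem x i = 1) :
  X i R := cp_mor x i R (exist (Dopen (cp_idem x i) R) (idfun : {rmorphism R -> R}) h).

Lemma cp_mor_at (R : comPzRingType) (x : coprod N X R) i (h : cp_idem x i = 1)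
    (T : comPzRingType) (f : Spec R T) hf :
  cp_mor x i T (exist (Dopen (cp_idem x i) T) f hf) = fmap (X i) f (at_pt h).
Proof.
rewrite /at_pt -mor_nat; congr (cp_mor x i _ _); apply: eq_exist.
exact: rmorph_ext.
Qed.

Lemma at_pt_nat (R S : comPzRingType) (g : {rmorphism R -> S}) (x : coprod N X R) i
    (h : cp_idem x i = 1) (h' : cp_idem (fmap (coprod N X) g x) i = 1) :
  at_pt h' = fmap (X i) g (at_pt h).
Proof.
have ge : g (cp_idem x i) = 1 by rewrite h rmorph1.
rewrite -(cp_mor_at h ge) /at_pt /=; congr (cp_mor x i _ _); apply: eq_exist.
exact: rmorph_ext.
Qed.

Lemma at_pt_other (R : comPzRingType) (x : coprod N X R) i k :
  cp_idem x i = 1 -> i != k -> cp_idem x k = 0.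
Proof. by move=> h ik; rewrite -[LHS]mul1r -h cp_orth. Qed.

Hypothesis X0 : forall i, zero_pt (X i).

Lemma Dopen0_trivial (R T : comPzRingType) (e : R) (f : Spec R T) :
  e = 0 -> Dopen e T f -> 1 = 0 :> T.
Proof. by move=> -> /= <-; rewrite rmorph0. Qed.

(** The other components are maps from the empty [D(0)], which carry no information
when [X_k] has one point over the zero ring. *)
Lemma at_pt_inj (R : comPzRingType) (x y : coprod N X R) i
    (hx : cp_idem x i = 1) (hy : cp_idem y i = 1) :
  at_pt hx = at_pt hy -> x = y.
Proof.
move=> xy; apply: coprod_ext => k.
  have [<-|ik] := eqVneq i k; first by rewrite hx hy.
  by rewrite (at_pt_other hx ik) (at_pt_other hy ik).
move=> T f fx fy; have [ik|ik] := eqVneq i k.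
  by subst k; rewrite (cp_mor_at hx) (cp_mor_at hy) xy.
by have [_] := X0 k (Dopen0_trivial (at_pt_other hx ik) fx); apply.
Qed.

Lemma Dopen0_mor (R : comPzRingType) (e : R) i :
  e = 0 -> exists phi : mor (sub (Dopen e)) (X i), True.
Proof.
move=> e0.
have h (T : comPzRingType) (f : sub (Dopen e) T) : exists x : X i T, True.
  by have [] := X0 i (Dopen0_trivial e0 (svalP f)).
have nat (S T : comPzRingType) (g : {rmorphism S -> T}) (f : sub (Dopen e) S) :
    sval (cid (h T (fmap (sub (Dopen e)) g f))) = fmap (X i) g (sval (cid (h S f))).
  by have [_] := X0 i (Dopen0_trivial e0 (svalP (fmap (sub (Dopen e)) g f))); apply.
by exists (Mor nat).
Qed.

Lemma coprod_in (R : comPzRingType) i (y : X i R) : (i < N)%N ->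
  exists (x : coprod N X R) (h : cp_idem x i = 1), at_pt h = y.
Proof.
move=> iN; pose e k : R := (i == k)%:R.
(* The map on the component [i] is dependently typed in [i]; it is specified by
   transport along [i = k] and left unspecified on the other components. *)
have H k : exists phi : mor (sub (Dopen (e k))) (X k), forall (E : i = k) T f,
    phi T f = fmap (X k) (sval f) (eq_rect i (fun k => X k R) y k E).
  have [ik|ik] := eqVneq i k.
    subst k.
    have nat (S T : comPzRingType) (g : {rmorphism S -> T}) (f : sub (Dopen (e i)) S) :
        fmap (X i) (sval (fmap (sub (Dopen (e i))) g f)) y
        = fmap (X i) g (fmap (X i) (sval f) y).
      by rewrite -fmap_comp.
    exists (Mor nat) => E T f /=.
    by rewrite (Prop_irrelevance E erefl).
  have [|phi _] := @Dopen0_mor R (e k) k; first by rewrite /e (negPf ik).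
  by exists phi => E; rewrite E eqxx in ik.
pose phi k := sval (cid (H k)).
have phiE : forall T f, phi i T f = fmap (X i) (sval f) y.
  by move=> T f; rewrite /phi; case: cid => p /= /(_ erefl T f) ->.
have orth k l : k != l -> e k * e l = 0.
  rewrite /e => kl; case: eqP => [ik|_]; last by rewrite mul0r.
  by rewrite ik (negPf kl) mulr0.
have out k : (N <= k)%N -> e k = 0.
  by move=> Nk; rewrite /e; case: eqP => // ik; move: Nk; rewrite -ik leqNgt iN.
have sum : \sum_(k < N) e k = 1.
  rewrite (bigD1 (Ordinal iN)) //= /e eqxx big1 ?addr0 // => k ki.
  by case: eqP => // ik; case/eqP: ki; apply: val_inj.
have h : cp_idem (CoprodPts phi orth out sum) i = 1 by rewrite /= /e eqxx.
by exists (CoprodPts phi orth out sum), h; rewrite /at_pt /= phiE /= fmap_id.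
Qed.

Definition comp_sub i (Z : subfunctor (X i)) : subfunctor (coprod N X).
Proof.
exists (fun R x => exists h : cp_idem x i = 1, Z R (at_pt h)).
move=> R S g x [h Zx].
have h' : cp_idem (fmap (coprod N X) g x) i = 1 by rewrite /= h rmorph1.
by exists h'; rewrite (at_pt_nat h); apply: sf_map.
Defined.

Lemma iso_comp_sub i (Z : subfunctor (X i)) : (i < N)%N ->
  isomorphic (sub (comp_sub Z)) (sub Z).
Proof.
move=> iN.
have ex (R : comPzRingType) (x : sub (comp_sub Z) R) :
    exists z : sub Z R, forall h : cp_idem (sval x) i = 1, at_pt h = sval z.
  case: x => x /= [h Zx]; exists (exist _ _ Zx) => h' /=.
  by rewrite (Prop_irrelevance h h').
pose F (R : comPzRingType) (x : sub (comp_sub Z) R) : sub Z R := sval (cid (ex R x)).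
have FE (R : comPzRingType) (x : sub (comp_sub Z) R) (h : cp_idem (sval x) i = 1) :
    at_pt h = sval (F R x).
  by rewrite /F; case: cid.
have FN (R S : comPzRingType) (g : {rmorphism R -> S}) (x : sub (comp_sub Z) R) :
    F S (fmap (sub (comp_sub Z)) g x) = fmap (sub Z) g (F R x).
  apply: sval_inj_prop; case: (svalP x) => h Zx.
  have h' : cp_idem (fmap (coprod N X) g (sval x)) i = 1 by rewrite /= h rmorph1.
  rewrite -(FE S (fmap (sub (comp_sub Z)) g x) h').
  by rewrite (@at_pt_nat _ _ g (sval x) i h h') FE.
apply: (@iso_intro _ _ (Mor FN)) => R /=.
  move=> x y xy; apply: sval_inj_prop; case: (svalP x) (svalP y) => hx _ [hy _].
  by apply: (@at_pt_inj _ _ _ i hx hy); rewrite !FE xy.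
move=> [z Zz]; have [x [h xz]] := coprod_in z iN.
have Zx : comp_sub Z R x by exists h; rewrite xz.
exists (exist _ x Zx); apply: sval_inj_prop => /=.
by rewrite -xz -(FE R (exist _ x Zx) h).
Qed.

(** [D(e_i)] is the spectrum of [A / (1 - e_i)], over which [x] becomes a point [y] of
[X_i]; a base change of [x] lies in [X_i] exactly when it factors through this
quotient, and then it comes from [y]. *)
Lemma coprod_local (A : comPzRingType) (x : coprod N X A) i :
  let e := cp_idem x i in let J := principal (1 - e) in
  exists y : X i (quot J), forall (R : comPzRingType) (f : {rmorphism A -> R})
      (h : cp_idem (fmap (coprod N X) f x) i = 1),
    exists2 g : {rmorphism quot J -> R}, g \o qpi J = f :> {rmorphism A -> R}
      & at_pt h = fmap (X i) g y.
Proof.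
move=> e J.
have h' : cp_idem (fmap (coprod N X) (qpi J) x) i = 1.
  rewrite /= -[RHS](rmorph1 (qpi J)); apply/esym/qpiP.
  by exists 1; rewrite mul1r.
exists (at_pt h') => R f h.
have [|g gE] := @principal_factor A R (1 - e) f.
  by rewrite rmorphB rmorph1 (h : f e = 1) subrr.
exists g => //; subst f.
have h2 : cp_idem (fmap (coprod N X) g (fmap (coprod N X) (qpi J) x)) i = 1.
  by rewrite -fmap_comp.
rewrite -(at_pt_nat h' h2); move: h h2.
rewrite fmap_comp => h h2; congr at_pt; exact: Prop_irrelevance.
Qed.

(** The open subset of [Spec A / (1 - e)] found on the component is moved to
[Spec A] by multiplying its functions by [e]. *)
Lemma open_comp i (U : subfunctor (X i)) : is_open U -> is_open (comp_sub U).
Proof.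
move=> /openP Uo; apply/openP => A x.
set e := cp_idem x i; pose J := principal (1 - e).
have [y yP] := coprod_local x i.
have [I IP] := Uo _ y.
exists (fun a => exists b, a = e * b /\ I (qpi J b)) => R f.
split=> [[h]|[n [a [c [aI aE]]]]].
  have [g gE ->] := yP R f h.
  case/IP => n [a [c [aI <-]]].
  exists n, (fun k => e * qrepr (a k)), c; split.
    by move=> k; exists (qrepr (a k)); rewrite qreprK.
  apply: eq_bigr => k _; rewrite rmorphM (h : f e = 1) mul1r; congr (_ * _).
  by rewrite -gE /= qreprK.
have h : cp_idem (fmap (coprod N X) f x) i = 1.
  rewrite /= -/e -[LHS]mulr1 -aE mulr_sumr; apply: eq_bigr => k _.
  have [b [-> _]] := aI k.
  by rewrite mulrCA -rmorphM mulrA /e cp_mulee.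
exists h; have [g gE ->] := yP R f h; apply/IP.
exists n, (fun k => qpi J (a k)), c; split; last first.
  by rewrite -aE; apply: eq_bigr => k _; rewrite -gE.
move=> k; have [b [-> Ib]] := aI k.
have -> : qpi J (e * b) = qpi J b; last by [].
by apply/esym/qpiP; exists b; rewrite mulrBr mulr1 [b * e]mulrC.
Qed.

Lemma lc_comp i (Z : subfunctor (X i)) :
  is_locally_closed Z -> is_locally_closed (comp_sub Z).
Proof.
case=> U [Uo ZU Zc]; exists (comp_sub U); split.
- exact: open_comp.
- by move=> R x [h Zx]; exists h; apply: ZU.
move=> A x [h Ux]; have [I IP] := Zc A _ Ux.
exists I => R f; rewrite -IP.
have h' : cp_idem (fmap (coprod N X) f x) i = 1 by rewrite /= h rmorph1.
rewrite -(at_pt_nat h h'); split=> [[h2]|]; last by exists h'.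
by rewrite (Prop_irrelevance h2 h').
Qed.

(** A field has no idempotents besides [0] and [1]. *)
Lemma coprod_field (K : fieldType) (x : coprod N X K) :
  exists i : 'I_N, cp_idem x i = 1.
Proof.
have [i ei] : exists i : 'I_N, cp_idem x i != 0.
  apply/existsP; rewrite -negb_forall; apply/negP => /forallP h.
  have := cp_sum x; rewrite big1 => [/eqP|i _]; last exact/eqP/h.
  by rewrite eq_sym oner_eq0.
by exists i; apply: (mulfI ei); rewrite cp_mulee mulr1.
Qed.

Lemma coprod_field_uniq (K : fieldType) (x : coprod N X K) i j :
  cp_idem x i = 1 -> cp_idem x j = 1 -> i = j.
Proof.
move=> hi hj; apply/eqP/contraT => ij.
by have := at_pt_other hi ij; rewrite hj => /eqP; rewrite oner_eq0.
Qed.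

End AtPoint.

(** * Partitions indexed by finite types *)

Definition fin_partition (X : zfunctor) (J : finType) (P : J -> subfunctor X) :=
  (forall j, is_locally_closed (P j)) /\
  (forall (k : fieldType) (x : X k), exists! j, P j k x).

Lemma fin_partition_ord (X : zfunctor) (J : finType) (P : J -> subfunctor X) :
  fin_partition P -> is_partition (fun r : 'I_#|J| => P (enum_val r)).
Proof.
case=> lc un; split=> // k x; have [j [Pj jU]] := un k x.
exists (enum_rank j); split=> [|r Pr]; first by rewrite enum_rankK.
by rewrite (jU _ Pr) enum_valK.
Qed.

Lemma coprod_partition N X (J : nat -> finType) (P : forall i, J i -> subfunctor (X i)) :
  (forall i, fin_partition (@P i)) ->
  fin_partition (fun j : {i : 'I_N & J i} => @comp_sub N X (tag j) (P _ (tagged j))).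
Proof.
move=> hP; split=> [[i j]|k x]; first by apply: lc_comp; have [] := hP i.
have [i h] := coprod_field x.
have [_ /(_ k (at_pt h)) [j [Pj jU]]] := hP i.
exists (Tagged (fun i : 'I_N => J i) j); split; first by exists h.
move=> [i' j'] /= [h' Pj']; have ii := val_inj (coprod_field_uniq h h'); subst i'.
by congr existT; apply: jU; rewrite (Prop_irrelevance h h').
Qed.

(** Pieces of the components are pieces of the coproduct; the zero-point hypotheses
say that the components sit inside their coproducts. *)
Lemma piecewise_coprod N (X Y : nat -> zfunctor) (J : nat -> finType)
    (P : forall i, J i -> subfunctor (X i)) (Q : forall i, J i -> subfunctor (Y i)) :
  (forall i, zero_pt (X i)) -> (forall i, zero_pt (Y i)) ->
  (forall i, fin_partition (@P i)) -> (forall i, fin_partition (@Q i)) ->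
  (forall i j, isomorphic (sub (P i j)) (sub (Q i j))) ->
  piecewise_isomorphic (coprod N X) (coprod N Y).
Proof.
move=> X0 Y0 hP hQ PQ.
pose part (Z : nat -> zfunctor) (W : forall i, J i -> subfunctor (Z i)) :=
  fun r : 'I_#|{: {i : 'I_N & J i}}| => @comp_sub N Z _ (W _ (tagged (enum_val r))).
exists #|{: {i : 'I_N & J i}}|, (part X P), (part Y Q); split.
- exact: fin_partition_ord (coprod_partition N hP).
- exact: fin_partition_ord (coprod_partition N hQ).
move=> r; have iN := ltn_ord (tag (enum_val r)).
apply: iso_trans (iso_comp_sub X0 _ iN) _.
by apply: iso_trans (PQ _ _) (iso_sym (iso_comp_sub Y0 _ iN)).
Qed.

(** * Coproducts of affine varieties are affine *)

Lemma qpi_idem (R : comPzRingType) (e : R) : qpi (principal (1 - e)) e = 1.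
Proof.
rewrite -[RHS](rmorph1 (qpi (principal (1 - e)))).
by apply/esym/qpiP; exists 1; rewrite mul1r.
Qed.

(** Multiplication by [e] is injective on [R / (1 - e)], and gives a canonical lift. *)
Lemma qpi_idem_eq (R : comPzRingType) (e x y : R) : e * e = e ->
  qpi (principal (1 - e)) x = qpi (principal (1 - e)) y -> e * x = e * y.
Proof.
move=> ee /qpiP[c cE]; apply/subr0_eq; rewrite -mulrBr cE mulrCA mulrBr mulr1.
by rewrite ee subrr mulr0.
Qed.

(** By Yoneda, since [D(e)] is the spectrum of [R / (1 - e)]: evaluate [phi] at the
quotient map and lift the coordinates by multiplication with [e]. *)
Lemma Dopen_vector (R : comPzRingType) (e : R) n (phi : mor (sub (Dopen e)) (Aff n)) :
  e * e = e -> exists v : 'rV[R]_n, e *: v = v /\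
    forall T (f : sub (Dopen e) T), phi T f = map_mx (sval f) v.
Proof.
move=> ee; pose J := principal (1 - e).
pose u : sub (Dopen e) (quot J) :=
  exist (Dopen e (quot J)) (qpi J : {rmorphism R -> quot J}) (qpi_idem e).
exists (e *: \row_j qrepr ((phi _ u : 'rV_n) 0 j)).
split=> [|T [f fe]]; first by rewrite scalerA ee.
have [|g gE] := @principal_factor R T (1 - e) f.
  by rewrite rmorphB rmorph1 (fe : f e = 1) subrr.
have gQ x : g (qpi J x) = f x by rewrite -gE.
have -> : exist (Dopen e T) f fe = fmap (sub (Dopen e)) g u.
  by apply: sval_inj_prop; rewrite /= -gE; apply: rmorph_ext.
rewrite mor_nat; apply/rowP => j; rewrite !mxE /= gQ rmorphM (fe : f e = 1) mul1r -gQ.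
by rewrite [qpi J _]qreprK.
Qed.

Lemma Dopen_vector_uniq (R : comPzRingType) (e : R) n (v w : 'rV[R]_n) :
  e * e = e -> e *: v = v -> e *: w = w ->
  (forall (T : comPzRingType) (f : {rmorphism R -> T}), f e = 1 -> map_mx f v = map_mx f w) ->
  v = w.
Proof.
move=> ee ev ew vw; apply/rowP => j.
have /rowP/(_ j) := vw _ (qpi (principal (1 - e))) (qpi_idem e).
rewrite !mxE => /(qpi_idem_eq ee) h.
by rewrite -[in LHS]ev -[in RHS]ew !mxE.
Qed.

Lemma closed_immersion_pad X n m (f : mor X (Aff n)) :
  is_closed_immersion f -> (n <= m)%N ->
  exists g : mor X (Aff m), is_closed_immersion g.
Proof.
move=> [Z [Zc imf]] /subnKC <-; move: (m - n)%N => k.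
have h (R S : comPzRingType) (g : {rmorphism R -> S}) (x : X R) :
    row_mx (f S (fmap X g x)) 0 = map_mx g (row_mx (f R x) 0) :> 'rV_(n + k).
  by rewrite map_row_mx map_mx0 mor_nat.
have lN (R S : comPzRingType) (g : {rmorphism R -> S}) (v : Aff (n + k) R) :
    lsubmx (map_mx g v : 'rV_(n + k)) = map_mx g (lsubmx (v : 'rV_(n + k))).
  by rewrite map_lsubmx.
exists (@Mor X (Aff (n + k)) (fun R x => row_mx (f R x) 0 : 'rV_(n + k)) h).
exists (andsub (pullback (@Mor (Aff (n + k)) (Aff n) (fun R v => lsubmx (v : 'rV_(n + k))) lN) Z)
  (zero_sub (fun j : 'I_(n + k) => (n <= j)%N))); split.
  by apply: closed_and; [apply: closed_pullback|apply: closed_zero].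
move=> R; have [fI fZ] := imf R; split=> [x y /= /eq_row_mx[/fI]//|v].
split=> [[/fZ/=[x xE] v0]|[x <-]].
  exists x; rewrite xE -[RHS]hsubmxK; congr row_mx; apply/rowP => j.
  by rewrite !mxE v0 //= leq_addr.
split; first by apply/fZ; exists x; rewrite /= row_mxKl.
move=> j /=; rewrite mxE; case: splitP => [i -> |i _ _]; last by rewrite mxE.
by rewrite leqNgt ltn_ord.
Qed.

(** An immersion is a monomorphism, so the pointwise preimages under [g] are
automatically natural. *)
Lemma lift_mor X Y W (g : mor Y X) (Z : subfunctor X) (h : mor W X) :
  image_is g Z -> (forall (R : comPzRingType) (x : W R), Z R (h R x)) ->
  exists phi : mor W Y, forall (R : comPzRingType) (x : W R), g R (phi R x) = h R x.
Proof.
move=> img hZ.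
have ex (R : comPzRingType) (x : W R) : exists y, g R y = h R x.
  by have [_ gZ] := img R; apply/gZ.
have nat (R S : comPzRingType) (f : {rmorphism R -> S}) (x : W R) :
    sval (cid (ex S (fmap W f x))) = fmap Y f (sval (cid (ex R x))).
  have [gI _] := img S; apply: gI; rewrite [RHS]mor_nat.
  by case: cid => y /= ->; case: cid => z /= ->; rewrite mor_nat.
by exists (Mor nat) => R x /=; case: cid.
Qed.

(** A point of the coproduct is recorded by its idempotents [e_i] and, for each
component embedded in [A^n], by the vector [v_i = e_i v_i] of [Dopen_vector].  All
components use the same [n]. *)
Section CoprodEmbedding.
Variables (N n : nat) (X : nat -> zfunctor).
Variables (g : forall i, mor (X i) (Aff n)) (Z : forall i : nat, subfunctor (Aff n)).
Hypothesis X0 : forall i, zero_pt (X i).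
Hypothesis Zc : forall i, (i < N)%N -> is_closed (Z i).
Hypothesis img : forall i, (i < N)%N -> image_is (g i) (Z i).

Let T := prodf (Aff N) (Mat N n).

Definition comp_vec_spec (R : comPzRingType) (x : coprod N X R) (i : nat) (v : 'rV[R]_n) :=
  cp_idem x i *: v = v /\
  forall (S : comPzRingType) (f : sub (Dopen (cp_idem x i)) S),
    g i S (cp_mor x i S f) = map_mx (sval f) v.

Lemma comp_vec_ex (R : comPzRingType) (x : coprod N X R) (i : nat) :
  exists v, comp_vec_spec x i v.
Proof.
have [v [ev vE]] := Dopen_vector (mor_comp (g i) (cp_mor x i)) (cp_mulee x i).
by exists v; split=> // S f; rewrite -vE.
Qed.

Definition comp_vec (R : comPzRingType) (x : coprod N X R) (i : nat) : 'rV[R]_n :=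
  sval (cid (comp_vec_ex x i)).

Lemma comp_vecP (R : comPzRingType) (x : coprod N X R) i : comp_vec_spec x i (comp_vec x i).
Proof. by rewrite /comp_vec; case: cid. Qed.

Lemma comp_vec_uniq (R : comPzRingType) (x : coprod N X R) i v :
  comp_vec_spec x i v -> comp_vec x i = v.
Proof.
move=> [ev vE]; have [ew wE] := comp_vecP x i.
apply: (@Dopen_vector_uniq _ (cp_idem x i)) => // [|S f fe]; first exact: cp_mulee.
pose f' : sub (Dopen (cp_idem x i)) S := exist (Dopen (cp_idem x i) S) f fe.
by rewrite -(wE S f') -(vE S f').
Qed.

Lemma comp_vec_nat (R S : comPzRingType) (f : {rmorphism R -> S}) (x : coprod N X R) i :
  comp_vec (fmap (coprod N X) f x) i = map_mx f (comp_vec x i).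
Proof.
apply: comp_vec_uniq; have [ev vE] := comp_vecP x i; split=> [|U h].
  by rewrite /= -[in RHS]ev; apply/rowP => j; rewrite !mxE rmorphM.
by rewrite /= vE /=; apply/rowP => j; rewrite !mxE.
Qed.

Definition coprod_embed : mor (coprod N X) T.
Proof.
exists (fun R x => (\row_i cp_idem x i, \matrix_(i, j) comp_vec x i 0 j)) => R S f x.
congr pair; apply/matrixP => i j; rewrite !mxE //.
by rewrite comp_vec_nat mxE.
Defined.

Definition orth_mor : mor T (Mat N N).
Proof.
exists (fun (R : comPzRingType) (x : T R) =>
  \matrix_(i, j) (if i != j then x.1 0 i * x.1 0 j else 0)) => R S f x.
by apply/matrixP => i j; rewrite !mxE; case: ifP => _; rewrite (rmorphM, rmorph0).
Defined.

Definition sum_mor : mor T (Aff 1).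
Proof.
exists (fun (R : comPzRingType) (x : T R) => \row__ \sum_i x.1 0 i) => R S f x.
by apply/rowP => i; rewrite !mxE rmorph_sum; apply: eq_bigr => j _; rewrite mxE.
Defined.

Definition scale_mor : mor T (Mat N n).
Proof.
exists (fun (R : comPzRingType) (x : T R) =>
  \matrix_(i, j) (x.1 0 i * x.2 i j)) => R S f x.
by apply/matrixP => i j; rewrite !mxE rmorphM.
Defined.

Definition const_mor (p q a : nat) : mor T (Mat p q).
Proof.
exists (fun (R : comPzRingType) (x : T R) => const_mx a%:R : 'M[R]_(p, q)) => R S f x.
by apply/matrixP => i j; rewrite !mxE rmorph_nat.
Defined.

Definition idem_eqs : subfunctor T :=
  andsub (eqsub orth_mor (const_mor N N 0))
    (andsub (eqsub sum_mor (const_mor 1 1 1)) (eqsub scale_mor (snd_mor _ _))).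

Definition comp_eqs : subfunctor T.
Proof.
exists (fun (R : comPzRingType) (x : T R) => forall (i : 'I_N) (S : comPzRingType)
  (f : {rmorphism R -> S}), f (x.1 0 i) = 1 -> Z i S (map_mx f (row i x.2))).
move=> R S f x h i U k ke; have := h i U (k \o f).
rewrite /= -map_row -map_mx_comp; apply.
by move: ke; rewrite mxE.
Defined.

(** Over [D(e_i)] the vector [v_i] must satisfy the equations [b = 0] of the
[i]-th image, which amounts to [e_i b = 0] over the whole ring once [e_i] is
idempotent. *)
Lemma closed_coprod_image : is_closed (andsub idem_eqs comp_eqs).
Proof.
have /closedP Ec : is_closed idem_eqs.
  by do 2?[apply: closed_and]; apply: closed_eq.
apply/closedP => A x; have [I IP] := Ec A x.
have exJ (i : 'I_N) : exists J : A -> Prop, forall (R : comPzRingType) (f : {rmorphism A -> R}),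
    Z i R (map_mx f (row i x.2)) <-> forall a, J a -> f a = 0.
  by have /closedP := Zc (ltn_ord i); apply.
pose J (i : 'I_N) := sval (cid (exJ i)).
have JP (i : 'I_N) : forall (R : comPzRingType) (f : {rmorphism A -> R}),
    Z i R (map_mx f (row i x.2)) <-> forall a, J i a -> f a = 0.
  by rewrite /J; case: cid.
exists (fun a => I a \/ exists i b, J i b /\ a = x.1 0 i * b) => R f.
have fx (i : 'I_N) (S : comPzRingType) (k : {rmorphism R -> S}) :
    map_mx k (row i (fmap T f x).2) = map_mx (k \o f) (row i x.2).
  by rewrite /= -map_row -map_mx_comp.
split=> [[Ef Cf] a [Ia|[i [b [Jb ->]]]]|h].
- by move: a Ia; apply/IP.
- (* Test the condition on the universal map with [e_i = 1]. *)
  set e := x.1 0 i; pose q := qpi (principal (1 - f e)).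
  have ee : f e * f e = f e.
    have [O [S _]] := Ef; have /matrixP/(_ 0 0) := S; rewrite !mxE mulr1n => S1.
    rewrite -[RHS]mulr1 -S1 (bigD1 i) //= mxE mulrDr mulr_sumr.
    rewrite big1 ?addr0 // => j ij; have /matrixP/(_ i j) := O.
    by rewrite !mxE eq_sym ij.
  have qb : q (f b) = 0.
    have := Cf i _ q; rewrite fx => /(_ _)/JP; apply=> //.
    by rewrite /= mxE; apply: qpi_idem.
  rewrite rmorphM -[RHS](mulr0 (f e)); apply: (qpi_idem_eq ee).
  by rewrite rmorph0.
split; first by apply/IP => a Ia; apply: h; left.
move=> i S k ke; rewrite fx; apply/JP => b Jb /=.
have : f (x.1 0 i * b) = 0 by apply: h; right; exists i, b.
move/(congr1 k); rewrite !rmorphM rmorph0.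
by move: ke; rewrite /= mxE => ->; rewrite mul1r.
Qed.

Lemma coprod_embed_closed : is_closed_immersion coprod_embed.
Proof.
exists (andsub idem_eqs comp_eqs); split; first exact: closed_coprod_image.
move=> R; split.
  move=> x y [] /rowP exy /matrixP vxy; apply: coprod_ext => i.
    have [iN|iN] := ltnP i N; last by rewrite !cp_out.
    by have := exy (Ordinal iN); rewrite !mxE.
  move=> S f hx hy; have [iN|iN] := ltnP i N; last first.
    by have [_] := X0 i (Dopen0_trivial (cp_out x iN) hx); apply.
  have [gI _] := img iN S; apply: gI.
  have [_ ->] := comp_vecP x i; have [_ ->] := comp_vecP y i; congr map_mx.
  by apply/rowP => j; have := vxy (Ordinal iN) j; rewrite !mxE.
move=> [e v]; split=> [[[O [Sm C]] W]|[x <-]]; last first.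
  split; last first.
    move=> i S f; rewrite /= mxE => fe; have [_ gZ] := img (ltn_ord i) S.
    have [_ vE] := comp_vecP x i.
    apply/gZ; exists (cp_mor x i S (exist (Dopen (cp_idem x i) S) f fe)).
    by rewrite vE; apply/rowP => j; rewrite !mxE.
  split; [|split]; apply/matrixP => i j; rewrite !mxE /=.
  - by case: ifP => // ij; rewrite cp_orth.
  - by rewrite mulr1n -[RHS](cp_sum x); apply: eq_bigr => k _; rewrite mxE.
  - by have [/rowP/(_ j)] := comp_vecP x i; rewrite !mxE.
(* The vectors [e] and [v] only have entries of index below [N]; the remaining
   idempotents are zero and the remaining maps are the ones from the empty [D(0)]. *)
pose e' i := if insub i is Some k then e 0 (k : 'I_N) else 0.
have e'E (k : 'I_N) : e' k = e 0 k by rewrite /e' valK.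
have H i : exists phi : mor (sub (Dopen (e' i))) (X i), forall k : 'I_N, k = i :> nat ->
    forall (S : comPzRingType) (f : sub (Dopen (e' i)) S), g i S (phi S f) = map_mx (sval f) (row k v).
  have [iN|iN] := ltnP i N; last first.
    have [|phi _] := @Dopen0_mor X X0 R (e' i) i.
      by rewrite /e' insubF // ltnNge iN.
    by exists phi => k ki; move: (ltn_ord k); rewrite ki ltnNge iN.
  pose k := Ordinal iN.
  have hN (S U : comPzRingType) (q : {rmorphism S -> U}) (f : sub (Dopen (e' i)) S) :
      map_mx (sval (fmap (sub (Dopen (e' i))) q f)) (row k v)
      = map_mx q (map_mx (sval f) (row k v)).
    by rewrite -map_mx_comp.
  have [U [f fe]|phi phiE] := @lift_mor (Aff n) (X i) (sub (Dopen (e' i))) (g i) (Z i)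
      (@Mor (sub (Dopen (e' i))) (Aff n) (fun S f => map_mx (sval f) (row k v)) hN) (img iN).
    by apply: (W k U f); rewrite -e'E.
  exists phi => l li U f; rewrite phiE /=; congr (map_mx _ (row _ _)).
  by apply: val_inj.
pose phi i := sval (cid (H i)).
have phiE i (k : 'I_N) : k = i :> nat ->
    forall (S : comPzRingType) (f : sub (Dopen (e' i)) S),
      g i S (phi i S f) = map_mx (sval f) (row k v).
  by move=> ki; rewrite /phi; case: cid => p /= /(_ k ki).
have out i : (N <= i)%N -> e' i = 0 by move=> iN; rewrite /e' insubF // ltnNge iN.
have orth i j : i != j -> e' i * e' j = 0.
  move=> ij; have [iN|iN] := ltnP i N; last by rewrite (out i) ?mul0r.
  have [jN|jN] := ltnP j N; last by rewrite (out j) ?mulr0.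
  have /matrixP/(_ (Ordinal iN) (Ordinal jN)) := O; rewrite !mxE /=.
  rewrite (e'E (Ordinal iN)) (e'E (Ordinal jN)).
  by case: eqP => [[ji]|//]; rewrite ji eqxx in ij.
have sum : \sum_(i < N) e' i = 1.
  have /matrixP/(_ 0 0) := Sm; rewrite !mxE mulr1n /= => <-.
  by apply: eq_bigr => i _; rewrite e'E.
exists (CoprodPts phi orth out sum); congr pair.
  by apply/rowP => i; rewrite mxE /= e'E.
apply/row_matrixP => i; rewrite -[RHS](@comp_vec_uniq _ (CoprodPts phi orth out sum) i).
  by apply/rowP => j; rewrite !mxE.
split=> [|U f]; last exact: phiE.
rewrite /= e'E; apply/rowP => j; have /matrixP/(_ i j) := C.
by rewrite !mxE /=.
Qed.

End CoprodEmbedding.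

Lemma affine_coprod N (X : nat -> zfunctor) :
  (forall i, is_affine (X i)) -> is_affine (coprod N X).
Proof.
move=> eX.
have X0 i := affine_zero_pt (eX i).
have [n nP] : exists n, forall i, (i < N)%N ->
    exists g : mor (X i) (Aff n), is_closed_immersion g.
  elim: N => [|N [n nP]]; first by exists 0%N.
  have [m [g gc]] := eX N.
  exists (n + m)%N => i; rewrite ltnS leq_eqVlt => /orP[/eqP->|/nP[h hc]].
    by apply: closed_immersion_pad gc _; rewrite leq_addl.
  by apply: closed_immersion_pad hc _; rewrite leq_addr.
have H i : exists p : mor (X i) (Aff n) * subfunctor (Aff n),
    (i < N)%N -> is_closed p.2 /\ image_is p.1 p.2.
  have [/nP[g [Z ?]]|iN] := ltnP i N; first by exists (g, Z).
  have zN (R S : comPzRingType) (f : {rmorphism R -> S}) (x : X i R) :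
      0 = map_mx f 0 :> 'rV_n by rewrite map_mx0.
  by exists (@Mor (X i) (Aff n) (fun R x => 0 : 'rV_n) zN, full_sub _).
pose p i := sval (cid (H i)).
have pP i : (i < N)%N -> is_closed (p i).2 /\ image_is (p i).1 (p i).2.
  by rewrite /p; case: cid.
apply: affine_closed_immersion (@coprod_embed_closed N n X (fun i => (p i).1) (fun i => (p i).2) X0 _ _).
- by apply: affine_prod; [apply: affine_Aff|apply: affine_Mat].
- by move=> i /pP[].
- by move=> i /pP[].
Qed.

(** The old coproduct is where the idempotent of the new component vanishes. *)
Definition last_zero N X : subfunctor (coprod N.+1 X).
Proof.
exists (fun (R : comPzRingType) (x : coprod N.+1 X R) => cp_idem x N = 0) => R S f x /= ->.
exact: rmorph0.
Defined.

Lemma last_zero_closed N X : is_closed (last_zero N X).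
Proof.
apply/closedP => A x; exists (fun a => a = cp_idem x N) => R f /=.
by split=> [e _ ->|e] //; apply: e.
Qed.

Lemma coprod_incl_image N X : image_is (coprod_incl N X) (last_zero N X).
Proof.
move=> R; split.
  move=> x y h; apply: coprod_ext => [i|i S f hx hy].
    by have /(congr1 (fun z : coprod N.+1 X R => cp_idem z i)) := h.
  pose Q (z : coprod N.+1 X R) (p : X i S) : Prop :=
    exists hz, cp_mor z i S (exist (Dopen (cp_idem z i) S) f hz) = p.
  have : Q (coprod_incl N X R x) (cp_mor x i S (exist (Dopen (cp_idem x i) S) f hx)).
    by exists hx.
  by rewrite h => -[hz <-]; rewrite (Prop_irrelevance hz hy).
move=> y; split=> [|[x <-]]; last by rewrite /= cp_out.
case: y => e u o1 o2 s /= e0.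
have o2' i : (N <= i)%N -> e i = 0.
  by rewrite leq_eqVlt => /orP[/eqP<-//|/o2].
have s' : \sum_(i < N) e i = 1 by rewrite -s big_ord_recr /= e0 addr0.
by exists (CoprodPts u o1 o2' s'); apply: coprod_pts_ext.
Qed.

Lemma coprod_incl_closed N X : is_closed_immersion (coprod_incl N X).
Proof.
by exists (last_zero N X); split; [apply: last_zero_closed|apply: coprod_incl_image].
Qed.

(** * Splitting off the first column of an invertible matrix *)

Section Pivot.
Variable m : nat.

(** The vectors whose first nonzero coordinate is [i], as a scheme. *)
Definition pivot_sub n (i : 'I_n) : subfunctor (Aff n) :=
  andsub (zero_sub (fun r : 'I_n => (r < i)%N)) (unit_sub i).

Definition colv : mor (Mat m.+1 m.+1) (Aff m.+1).
Proof.
exists (fun (R : comPzRingType) (A : 'M[R]_m.+1) => \row_r A r 0) => R S f A.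
by apply/rowP => j; rewrite !mxE.
Defined.

Definition toprow (i : 'I_m.+1) : mor (Mat m.+1 m.+1) (Aff m).
Proof.
exists (fun (R : comPzRingType) (A : 'M[R]_m.+1) => \row_c A i (lift 0 c)) => R S f A.
by apply/rowP => j; rewrite !mxE.
Defined.

(** The Schur complement of the entry [(i, 0)], multiplied by this entry to avoid
denominators. *)
Definition schur (i : 'I_m.+1) : mor (Mat m.+1 m.+1) (Mat m m).
Proof.
exists (fun (R : comPzRingType) (A : 'M[R]_m.+1) =>
  \matrix_(r, c) (A i 0 * A (lift i r) (lift 0 c) - A (lift i r) 0 * A i (lift 0 c))).
by move=> R S f A; apply/matrixP => r c; rewrite !mxE rmorphB !rmorphM.
Defined.

Definition pivot_mx (i : 'I_m.+1) : subfunctor (Mat m.+1 m.+1) :=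
  pullback colv (pivot_sub i).

Definition split_mx (i : 'I_m.+1) :
  mor (sub (pivot_mx i)) (prodf (sub (pivot_sub i)) (prodf (Aff m) (Mat m m))).
Proof.
exists (fun (R : comPzRingType) (A : sub (pivot_mx i) R) =>
  (exist (pivot_sub i R) (colv R (sval A)) (svalP A),
   (toprow i R (sval A), schur i R (sval A)))) => R S f A.
congr pair; first by apply: sval_inj_prop; rewrite [LHS](mor_nat colv).
by congr pair; rewrite ?(mor_nat (toprow i)) ?(mor_nat (schur i)).
Defined.

Lemma split_mx_bij (i : 'I_m.+1) (R : comPzRingType) :
  bijective (@mor_fun _ _ (split_mx i) R).
Proof.
apply: inj_surj_bij.
  move=> [A [A0 [u Au]]] [B [B0 Bu]] /= [] /rowP AB0 /rowP AB1 /matrixP AB.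
  have e0 r : A r 0 = B r 0 by have := AB0 r; rewrite !mxE.
  have e1 c : A i (lift 0 c) = B i (lift 0 c) by have := AB1 c; rewrite !mxE.
  have {}Au' : A i 0 * u = 1 by move: Au; rewrite mxE.
  apply: sval_inj_prop; apply/matrixP => r c /=.
  case: (unliftP 0 c) => [c' ->|->]; last exact: e0.
  case: (unliftP i r) => [r' ->|->]; last exact: e1.
  have := AB r' c'; rewrite !mxE -!e0 -e1 => /(congr1 (fun x => u * (x + A (lift i r') 0 * A i (lift 0 c')))).
  by rewrite !subrK !mulrA [u * _]mulrC Au' !mul1r.
(* [u] is the inverse of the pivot; the entries off the pivot row and the first
   column are solved for from the Schur complement. *)
move=> [[v [v0 [u vu]]] [w B]].
pose A : 'M[R]_m.+1 := \matrix_(r, c)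
  match unlift 0 c with
  | None => (v : 'rV_m.+1) 0 r
  | Some c' => match unlift i r with
    | None => (w : 'rV_m) 0 c'
    | Some r' => u * ((B : 'M_m) r' c' + (v : 'rV_m.+1) 0 r * (w : 'rV_m) 0 c')
    end
  end.
have A0 r : A r 0 = (v : 'rV_m.+1) 0 r by rewrite mxE unlift_none.
have A1 c : A i (lift 0 c) = (w : 'rV_m) 0 c by rewrite mxE liftK unlift_none.
have A2 r c : A (lift i r) (lift 0 c)
    = u * ((B : 'M_m) r c + (v : 'rV_m.+1) 0 (lift i r) * (w : 'rV_m) 0 c).
  by rewrite mxE !liftK.
clearbody A.
have Av : colv R A = v by apply/rowP => r; rewrite mxE A0.
have hA : pivot_sub i R (colv R A) by rewrite Av; split=> //; exists u.
exists (exist (pivot_mx i R) A hA); congr pair; first by apply: sval_inj_prop.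
congr pair; first by apply/rowP => c; rewrite mxE A1.
apply/matrixP => r c; rewrite !mxE /= A2 !A0 A1 mulrA vu mul1r.
exact: addrK.
Qed.

(** Reading [A] off from its pivot column, its pivot row and its Schur
complement identifies matrices with this pivot with a product; conditions on
the Schur complement become conditions on the last factor. *)
Lemma iso_pivot (i : 'I_m.+1) (C : subfunctor (Mat m m)) (D : subfunctor (Mat m.+1 m.+1)) :
  (forall R A, D R A <-> pivot_mx i R A /\ C R (schur i R A)) ->
  isomorphic (sub D) (prodf (sub (pivot_sub i)) (prodf (Aff m) (sub C))).
Proof.
move=> DP.
pose W : subfunctor (sub (pivot_mx i)) := pullback (mor_comp (schur i) (incl _)) C.
apply: (@iso_trans _ (sub W)).
  apply/iso_sym/iso_sub_sub => R A; rewrite DP; split=> [[h CA]|[h CA]].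
    by exists h.
  by split.
apply: iso_trans (@iso_sub _ _ (split_mx i) W
  (pullback (snd_mor _ _) (pullback (snd_mor _ _) C)) (split_mx_bij i) _) _.
  by [].
apply: iso_trans (iso_sym (iso_prod_sub _ _)) _.
by apply: iso_prod; [apply: iso_refl|apply/iso_sym/iso_prod_sub].
Qed.

Lemma unit_mulP (R : comPzRingType) (x y : R) :
  (exists z, x * y * z = 1) <-> (exists z, x * z = 1) /\ (exists z, y * z = 1).
Proof.
split=> [[z e]|[[a xa] [b yb]]].
  by split; [exists (y * z)|exists (x * z)]; rewrite mulrA // [y * x]mulrC.
by exists (a * b); rewrite mulrACA xa yb mulr1.
Qed.

Lemma unit_exp (R : comPzRingType) (x : R) k :
  (exists z, x * z = 1) -> exists z, x ^+ k * z = 1.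
Proof. by case=> z xz; exists (z ^+ k); rewrite -exprMn xz expr1n. Qed.

(** Eliminating the first column with the pivot multiplies the determinant by
a power of the pivot, up to sign. *)
Lemma GL_schur (i : 'I_m.+1) (R : comPzRingType) (A : 'M[R]_m.+1) :
  pivot_mx i R A -> GL_sub m.+1 R A <-> GL_sub m R (schur i R A).
Proof.
case=> _ [u' Au]; rewrite mxE in Au; set u := A i 0 in Au.
have uu : exists z, u * z = 1 by exists u'.
(* Move the pivot row to the top. *)
pose A' : 'M[R]_(1 + m) := row_perm (lift_perm 0 i 1%g) A.
have A0 c : A' 0 c = A i c by rewrite mxE lift_perm_id.
have A1 r c : A' (lift 0 r) c = A (lift i r) c by rewrite mxE lift_perm_lift perm1.
pose E : 'M[R]_(1 + m) := block_mx 1%:M 0 (- dlsubmx A') (u%:M).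
have dA : \det A' = (-1) ^+ (lift_perm 0 i 1%g : 'S_m.+1) * \det A.
  by rewrite /A' row_permE det_mulmx det_perm.
clearbody A'.
have EA : E *m A' = block_mx (u%:M) (ursubmx A') 0 (schur i R A).
  rewrite -[A' in LHS]submxK mulmx_block !mul0mx !mul1mx !addr0.
  congr block_mx.
  - by apply/matrixP => r c; rewrite !ord1 !mxE lshift0 A0 mulr1n.
  - apply/matrixP => r c; rewrite mul_scalar_mx !mxE big_ord1 !mxE (ord1 c) !lshift0 !rshift1.
    by rewrite A0 !A1 mulNr mulrC addNr.
  apply/matrixP => r c; rewrite mul_scalar_mx !mxE big_ord1 !mxE !lshift0 !rshift1.
  by rewrite A0 !A1 mulNr addrC.
have dE : \det E = u ^+ m by rewrite det_lblock det1 mul1r det_scalar.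
have := congr1 determinant EA.
rewrite det_mulmx det_ublock dE dA det_scalar1 => key.
rewrite !GL_sub_det.
have sgn : exists z, (-1) ^+ (lift_perm 0 i 1%g : 'S_m.+1) * z = 1 :> R.
  by exists ((-1) ^+ (lift_perm 0 i 1%g : 'S_m.+1)); rewrite -expr2 sqrr_sign.
split=> h.
  have [|_] := (unit_mulP u (\det (schur i R A))).1; last by [].
  by rewrite -key; apply/unit_mulP; split; [apply: unit_exp|apply/unit_mulP].
have [|_] := (unit_mulP (u ^+ m) ((-1) ^+ (lift_perm 0 i 1%g : 'S_m.+1) * \det A)).1.
  by rewrite key; apply/unit_mulP.
by case/unit_mulP.
Qed.

Lemma lc_pivot n (i : 'I_n) : is_locally_closed (pivot_sub i).
Proof. by apply: lc_closed_open; [apply: closed_zero|apply: open_unit]. Qed.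

Lemma pivot_field (K : fieldType) n (v : 'rV[K]_n) :
  v != 0 -> exists! i, pivot_sub i K v.
Proof.
case/rV0Pn => i0 vi0; pose i := [arg min_(i < i0 | v ord0 i != 0%R) i]%N.
have [vi imin] : v 0 i != 0 /\ forall j, v 0 j != 0 -> (i <= j)%N.
  by rewrite /i; case: arg_minnP.
have uni (j : 'I_n) : (exists y, v 0 j * y = 1) <-> v 0 j != 0.
  split=> [[y e]|vj]; last by exists (v 0 j)^-1; rewrite divff.
  by apply: contra_eq_neq e => ->; rewrite mul0r eq_sym oner_eq0.
exists i; split.
  split=> [j ji|]; last exact/uni.
  by apply/eqP; apply: contraLR ji => /imin; rewrite leqNgt.
move=> j [vj /uni uj]; apply/val_inj/eqP; rewrite eqn_leq imin //= leqNgt.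
by apply: contra vi => /vj ->.
Qed.

End Pivot.

(** * The pieces of GL and of the flag products *)

(** The dimension [m (m - 1) / 2] of the unipotent triangular matrices: one row to
the right of each pivot. *)
Fixpoint unip_dim (m : nat) : nat := if m is m'.+1 then m' + unip_dim m' else 0.

(** The pivot positions met when the first column is split off repeatedly. *)
Fixpoint pivots (m : nat) : finType :=
  if m is m'.+1 then ('I_m'.+1 * pivots m')%type : finType else unit : finType.

(** The pieces are defined among all matrices, because the Schur complement is not
known to be invertible before the pivot condition is used; they consist of
invertible matrices by [mx_piece_GL]. *)
Fixpoint mx_piece (m : nat) : pivots m -> subfunctor (Mat m m) :=
  match m with
  | 0 => fun _ => full_sub (Mat 0 0)
  | m'.+1 => fun s => andsub (pivot_mx s.1) (pullback (schur s.1) (mx_piece s.2))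
  end.

Fixpoint flag_piece (m : nat) : pivots m -> subfunctor (flag_prod m) :=
  match m with
  | 0 => fun _ => full_sub pt
  | m'.+1 => fun s => andsub
      (pullback (mor_comp (incl _) (fst_mor (Aff_minus0 m'.+1) (flag_prod m'))) (pivot_sub s.1))
      (pullback (snd_mor _ _) (flag_piece s.2))
  end.

Definition GL_piece m (s : pivots m) : subfunctor (GL m) :=
  pullback (incl (GL_sub m)) (mx_piece s).

Definition cell_piece m (s : pivots m) : subfunctor (prodf (Aff (unip_dim m)) (flag_prod m)) :=
  pullback (snd_mor _ _) (flag_piece s).

Lemma lc_full (X : zfunctor) : is_locally_closed (full_sub X).
Proof.
apply: lc_closed; apply/closedP => A x; exists (fun=> False) => R f.
by split.
Qed.

Lemma lc_mx_piece m (s : pivots m) : is_locally_closed (mx_piece s).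
Proof.
elim: m s => [|m IHm] s; first exact: lc_full.
by apply: lc_and; apply: lc_pullback; [apply: lc_pivot|apply: IHm].
Qed.

Lemma lc_flag_piece m (s : pivots m) : is_locally_closed (flag_piece s).
Proof.
elim: m s => [|m IHm] s; first exact: lc_full.
by apply: lc_and; apply: lc_pullback; [apply: lc_pivot|apply: IHm].
Qed.

Lemma GL_0 (R : comPzRingType) (A : 'M[R]_0) : GL_sub 0 R A.
Proof. by exists 0; split; rewrite [LHS]flatmx0 [RHS]flatmx0. Qed.

Lemma GL_colv (K : fieldType) m (A : 'M[K]_m.+1) :
  GL_sub m.+1 K A -> colv m K A != 0 :> 'rV_m.+1.
Proof.
case=> B [_ BA]; apply/negP => /eqP/rowP A0.
have := congr1 (fun M : 'M_m.+1 => M 0 0) BA; rewrite !mxE eqxx big1.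
  by move/eqP; rewrite eq_sym oner_eq0.
by move=> j _; have := A0 j; rewrite !mxE => ->; rewrite mulr0.
Qed.

(** Over a field the first column of an invertible matrix is nonzero, which
determines its pivot, and the Schur complement is again invertible. *)
Lemma mx_piece_field (K : fieldType) m (A : 'M[K]_m) :
  GL_sub m K A -> exists! s, mx_piece s K A.
Proof.
elim: m A => [|m IHm] A hA; first by exists tt; split=> // [[]].
have [i [vi iU]] := pivot_field (GL_colv hA).
have /IHm[s [As sU]] := (GL_schur vi).1 hA.
exists (i, s); split=> [|[j t] [/= vj At]]; first by split.
by have ij := iU j vj; subst j; rewrite (sU t).
Qed.

Lemma mx_piece_GL (R : comPzRingType) m (s : pivots m) (A : 'M[R]_m) :
  mx_piece s R A -> GL_sub m R A.
Proof.
elim: m s A => [|m IHm] s A; first by move=> _; apply: GL_0.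
by case=> pA As; apply/(GL_schur pA)/(IHm s.2).
Qed.

Lemma GL_partition m : fin_partition (@GL_piece m).
Proof.
split=> [s|k [A hA]]; first by apply: lc_pullback; apply: lc_mx_piece.
exact: mx_piece_field.
Qed.

Lemma Aff_minus0_field (K : fieldType) n (v : Aff_minus0 n K) : sval v != 0 :> 'rV_n.
Proof.
case: v => v /= h; apply/negP => /eqP v0.
have := h K idfun; rewrite /= map_mx_id // => /(_ v0)/eqP.
by rewrite oner_eq0.
Qed.

Lemma flag_piece_field (K : fieldType) m (x : flag_prod m K) :
  exists! s, flag_piece s K x.
Proof.
elim: m x => [|m IHm] x; first by exists tt; split=> // [[]].
case: x => v x; have [i [vi iU]] := pivot_field (Aff_minus0_field v).
have [s [xs sU]] := IHm x.
exists (i, s); split=> [|[j t] [/= vj xt]]; first by split.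
by have ij := iU j vj; subst j; rewrite (sU t).
Qed.

Lemma cell_partition m : fin_partition (@cell_piece m).
Proof.
split=> [s|k [A x]]; first by apply: lc_pullback; apply: lc_flag_piece.
exact: flag_piece_field.
Qed.

Lemma pivot_minus0 (R : comPzRingType) n (i : 'I_n) (v : 'rV[R]_n) :
  pivot_sub i R v -> compl (origin n) R v.
Proof.
case=> _ [y vy] S f /= /rowP/(_ i); rewrite !mxE => vi.
by rewrite -(rmorph1 f) -vy rmorphM vi mul0r.
Qed.

Lemma iso_flag_piece m (i : 'I_m.+1) (s : pivots m) :
  isomorphic (prodf (sub (pivot_sub i)) (sub (flag_piece s)))
             (sub (@flag_piece m.+1 (i, s))).
Proof.
have iN (R S : comPzRingType) (f : {rmorphism R -> S}) (x : prodf (sub (pivot_sub i)) (sub (flag_piece s)) R) :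
  (exist _ (fmap (Aff _) f (sval x.1)) (pivot_minus0 (svalP (fmap (sub (pivot_sub i)) f x.1))), fmap _ f (sval x.2))
   = fmap (flag_prod m.+1) f (exist _ (sval x.1) (pivot_minus0 (svalP x.1)), sval x.2).
  by congr pair; apply: sval_inj_prop.
pose F := @Mor (prodf (sub (pivot_sub i)) (sub (flag_piece s))) (flag_prod m.+1)
   (fun R x => (exist _ (sval x.1) (pivot_minus0 (svalP x.1)), sval x.2)) iN.
have FP (R : comPzRingType) (x : prodf (sub (pivot_sub i)) (sub (flag_piece s)) R) :
    @flag_piece m.+1 (i, s) R (F R x).
  by case: x => [[v pv] [x px]]; split.
apply: (@iso_intro _ _ (cores FP)) => R.
  by move=> [[v pv] [x px]] [[v' pv'] [x' px']] /= [vv xx]; congr pair; apply: eq_exist.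
move=> [[[v hv] x] [/= pv px]]; exists (exist _ v pv, exist _ x px).
by apply: eq_exist; congr pair; apply: eq_exist.
Qed.

Lemma iso_shuffle (V A D F : zfunctor) :
  isomorphic (prodf V (prodf A (prodf D F))) (prodf (prodf A D) (prodf V F)).
Proof.
exists (@Mor (prodf V (prodf A (prodf D F))) (prodf (prodf A D) (prodf V F))
  (fun R x => ((x.2.1, x.2.2.1), (x.1, x.2.2.2))) (fun _ _ _ _ => erefl)).
move=> R; exists (fun x => (x.2.1, (x.1.1, (x.1.2, x.2.2)))).
  by move=> [v [a [d f]]].
by move=> [[a d] [v f]].
Qed.

(** The columns split off from the matrix are the factors of the flag product, and
the pivot rows make up the affine space. *)
Lemma iso_mx_piece m (s : pivots m) :
  isomorphic (sub (mx_piece s)) (prodf (Aff (unip_dim m)) (sub (flag_piece s))).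
Proof.
elim: m s => [|m IHm] s.
  have N (R S : comPzRingType) (f : {rmorphism R -> S}) (x : sub (mx_piece s) R) :
      (0, exist (@flag_piece 0 tt S) tt Logic.I)
      = fmap (prodf (Aff 0) (sub (@flag_piece 0 tt))) f
          (0 : 'rV_0, exist (@flag_piece 0 tt R) tt Logic.I).
    by congr pair; rewrite /= ?map_mx0 //; apply: eq_exist.
  apply: (@iso_intro _ _ (@Mor _ (prodf (Aff 0) (sub (@flag_piece 0 tt))) _ N)) => R.
    by move=> [x []] [y []] _; apply: sval_inj_prop; rewrite [LHS]flatmx0 [RHS]flatmx0.
  move=> [v [[] []]]; exists (exist _ (0 : 'M_0) Logic.I).
  by congr pair; rewrite [RHS]thinmx0.
case: s => i s.
apply: (iso_trans (@iso_pivot m i (mx_piece s) (@mx_piece m.+1 (i, s)) (fun _ _ => iff_refl _))).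
apply: iso_trans (iso_prod (iso_refl _) (iso_prod (iso_refl _) (IHm s))) _.
apply: iso_trans (iso_shuffle _ _ _ _) _.
by apply: iso_prod (iso_Aff_prod _ _) (iso_flag_piece _ _).
Qed.

Lemma iso_GL_cell m (s : pivots m) : isomorphic (sub (GL_piece s)) (sub (cell_piece s)).
Proof.
apply: (@iso_trans _ (sub (mx_piece s))).
  apply: iso_sub_sub => R A; split=> [As|[hA As]] //.
  by exists (mx_piece_GL As).
by apply: iso_trans (iso_mx_piece s) (iso_prod_sub _ _).
Qed.

Lemma zero_pt_prod X Y : zero_pt X -> zero_pt Y -> zero_pt (prodf X Y).
Proof.
move=> X0 Y0 R e; have [[x _] xU] := X0 R e; have [[y _] yU] := Y0 R e.
split; first by exists (x, y).
by move=> [a b] [c d]; rewrite (xU a c) (yU b d).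
Qed.

Lemma flag_zero_pt m : zero_pt (flag_prod m).
Proof.
elim: m => [|m IHm]; first by move=> R e; split; [exists tt|move=> [] []].
apply: zero_pt_prod IHm => R e; split.
  have h : compl (origin m.+1) R (0 : 'rV_m.+1).
    by move=> S f _; rewrite -(rmorph1 f) e rmorph0.
  by exists (exist _ _ h).
move=> x y; apply: sval_inj_prop; apply/rowP => j; exact: trivial_ring.
Qed.

Lemma piecewise_GL N :
  piecewise_isomorphic (coprod N GL)
    (coprod N (fun m => prodf (Aff (unip_dim m)) (flag_prod m))).
Proof.
apply: (@piecewise_coprod N _ _ pivots (fun m => @GL_piece m) (fun m => @cell_piece m)).
- by move=> m; apply/affine_zero_pt/affine_GL.
- by move=> m; apply: zero_pt_prod (flag_zero_pt m); apply/affine_zero_pt/affine_Aff.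
- exact: GL_partition.
- exact: cell_partition.
- exact: iso_GL_cell.
Qed.

(** * The Grothendieck ring *)

Local Infix "==K" := K0eq (at level 70).
Local Notation "0k" := K0zero.
Local Notation "1k" := K0one.
Local Notation "a +k b" := (K0add a b) (at level 50, left associativity).
Local Notation "a *k b" := (K0mul a b) (at level 40, left associativity).
Local Notation "-k a" := (K0opp a) (at level 35).

Definition K0sub a b := a +k (-k b).

#[local] Instance K0eq_equiv : RelationClasses.Equivalence K0eq.
Proof. by split=> [a|a b|a b c]; [apply: K0refl|apply: K0sym|apply: K0trans]. Qed.

#[local] Instance K0add_proper :
  Morphisms.Proper (Morphisms.respectful K0eq (Morphisms.respectful K0eq K0eq)) K0add.
Proof. by move=> a a' aa b b' bb; apply: K0cong_add. Qed.

#[local] Instance K0mul_proper :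
  Morphisms.Proper (Morphisms.respectful K0eq (Morphisms.respectful K0eq K0eq)) K0mul.
Proof. by move=> a a' aa b b' bb; apply: K0cong_mul. Qed.

#[local] Instance K0opp_proper :
  Morphisms.Proper (Morphisms.respectful K0eq K0eq) K0opp.
Proof. by move=> a a' aa; apply: K0cong_opp. Qed.

(** The Grothendieck ring is a ring up to [K0eq], which is enough for reflexive
ring normalization. *)
Lemma K0_ring_theory :
  Ring_theory.ring_theory K0zero K0one K0add K0mul K0sub K0opp K0eq.
Proof.
split=> *.
- exact: K0add0.
- exact: K0addC.
- exact: K0addA.
- exact: K0mul1.
- exact: K0mulC.
- exact: K0mulA.
- exact: K0mulDl.
- exact: K0refl.
by apply: K0trans (K0addC _ _) (K0addN _).
Qed.

Lemma K0_ring_ext : Ring_theory.ring_eq_ext K0add K0mul K0opp K0eq.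
Proof.
by split; [apply: K0add_proper|apply: K0mul_proper|apply: K0opp_proper].
Qed.

Add Ring K0_ring : K0_ring_theory (setoid K0eq_equiv K0_ring_ext).

Lemma K0nat_add m n : K0nat (m + n) ==K K0nat m +k K0nat n.
Proof.
elim: m => [|m IHm]; first by rewrite add0n /=; ring.
by rewrite addSn /= IHm; ring.
Qed.

Lemma K0nat_mul m n : K0nat (m * n) ==K K0nat m *k K0nat n.
Proof.
elim: m => [|m IHm]; first by rewrite mul0n /=; ring.
by rewrite mulSn /= K0nat_add IHm; ring.
Qed.

Lemma K0int_sub (m n : nat) : K0int (m%:Z - n%:Z) ==K K0nat m +k -k K0nat n.
Proof.
have [mn|nm] := ltnP m n; last first.
  by rewrite subzn // -{2}(subnK nm) K0nat_add /=; ring.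
have -> : m%:Z - n%:Z = Negz (n - m).-1.
  by rewrite NegzE prednK ?subn_gt0 // -subzn 1?ltnW // opprB.
rewrite /K0int prednK ?subn_gt0 // -{2}(subnK (ltnW mn)) K0nat_add.
by ring.
Qed.

(** Writing integers as differences of naturals avoids sign distinctions in the two
lemmas that follow. *)
Lemma int_diff (z : int) : exists m n : nat, z = m%:Z - n%:Z.
Proof.
by case: z => n; [exists n, 0%N; rewrite subr0|exists 0%N, n.+1; rewrite sub0r NegzE].
Qed.

Lemma K0int_add a b : K0int (a + b) ==K K0int a +k K0int b.
Proof.
have [m [n ->]] := int_diff a; have [p [q ->]] := int_diff b.
have -> : m%:Z - n%:Z + (p%:Z - q%:Z) = (m + p)%N%:Z - (n + q)%N%:Z.
  by rewrite !PoszD opprD addrACA.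
by rewrite !K0int_sub !K0nat_add; ring.
Qed.

Lemma K0int_mul a b : K0int (a * b) ==K K0int a *k K0int b.
Proof.
have [m [n ->]] := int_diff a; have [p [q ->]] := int_diff b.
have -> : (m%:Z - n%:Z) * (p%:Z - q%:Z)
    = (m * p + n * q)%N%:Z - (m * q + n * p)%N%:Z.
  by rewrite !PoszD !PoszM mulrBl !mulrBr opprB opprD addrACA [- _ - _]addrC addrA.
by rewrite !K0int_sub !K0nat_add !K0nat_mul; ring.
Qed.

Lemma K0eval_cons (p : {poly int}) (c : int) :
  K0eval (p * 'X + c%:P) ==K K0eval p *k K0L +k K0int c.
Proof.
rewrite -cons_poly_def /K0eval polyseq_cons; case: ifP => [_|/negbFE/nilP ->].
  by reflexivity.
rewrite polyseqC; case: eqP => [->|_] /=; ring.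
Qed.

Lemma K0eval0 : K0eval 0 ==K 0k.
Proof. by rewrite /K0eval polyseq0; reflexivity. Qed.

Lemma K0evalC (c : int) : K0eval c%:P ==K K0int c.
Proof.
have := K0eval_cons 0 c; rewrite mul0r add0r => ->.
by rewrite K0eval0; ring.
Qed.

Lemma K0eval1 : K0eval 1 ==K 1k.
Proof. by rewrite K0evalC /=; ring. Qed.

Lemma K0evalD (p q : {poly int}) : K0eval (p + q) ==K K0eval p +k K0eval q.
Proof.
elim/poly_ind: p q => [|p c IHp] q; first by rewrite add0r K0eval0; ring.
elim/poly_ind: q => [|q d _]; first by rewrite addr0 K0eval0; ring.
by rewrite addrACA -mulrDl -polyCD !K0eval_cons IHp K0int_add; ring.
Qed.

Lemma K0evalN (p : {poly int}) : K0eval (- p) ==K -k K0eval p.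
Proof.
have := K0evalD p (- p); rewrite subrr K0eval0 => e.
transitivity (K0eval p +k K0eval (- p) +k -k K0eval p); first by ring.
by rewrite -e; ring.
Qed.

Lemma K0eval_MX (p : {poly int}) : K0eval (p * 'X) ==K K0eval p *k K0L.
Proof. by have := K0eval_cons p 0; rewrite addr0 => -> /=; ring. Qed.

Lemma K0eval_CM (c : int) (p : {poly int}) :
  K0eval (c%:P * p) ==K K0int c *k K0eval p.
Proof.
elim/poly_ind: p => [|p d IHp]; first by rewrite mulr0 K0eval0; ring.
by rewrite mulrDr mulrA -polyCM !K0eval_cons IHp K0int_mul; ring.
Qed.

Lemma K0evalM (p q : {poly int}) : K0eval (p * q) ==K K0eval p *k K0eval q.
Proof.
elim/poly_ind: p => [|p c IHp]; first by rewrite mul0r K0eval0; ring.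
by rewrite mulrDl mulrAC K0evalD K0eval_MX K0eval_CM K0eval_cons IHp; ring.
Qed.

(** * The class of GL *)

Definition of_affine X (h : is_affine X) : variety := Variety (affine_variety h).

Lemma K0_iso X Y (hX : is_affine X) (hY : is_affine Y) :
  isomorphic X Y -> K0cls (of_affine hX) ==K K0cls (of_affine hY).
Proof. by move=> XY; apply: K0iso. Qed.

Lemma K0_Aff n (h : is_variety (Aff n)) : K0cls (Variety h) ==K K0eval 'X^n.
Proof.
elim: n h => [|n IHn] h.
  rewrite expr0 K0eval1; apply: K0pt.
  exists (@Mor (Aff 0) pt (fun _ _ => tt) (fun _ _ _ _ => erefl)) => R.
  by exists (fun _ => (0 : 'rV_0)) => [v|[]] //=; rewrite [RHS]thinmx0.
rewrite exprSr K0eval_MX -(IHn (affine_variety (affine_Aff n))) /K0L.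
rewrite K0mulC; apply: K0prod; apply: iso_sym.
exact: (@iso_Aff_prod 1 n).
Qed.

(** The empty variety is its own complement in itself, so that its class satisfies
[a = a + a]. *)
Lemma K0_empty (X : variety) :
  (forall (R : comPzRingType) (x : X R), 1 = 0 :> R) -> K0cls X ==K 0k.
Proof.
move=> X0.
have e : K0cls X ==K K0cls X +k K0cls X.
  apply: (@K0scissor X X X (full_sub X)).
  - by apply/closedP => A x; exists (fun=> False).
  - by apply/iso_sym/iso_sub_full.
  by apply/iso_sym/iso_sub_full => R x S f _; apply: X0 (fmap X f x).
transitivity (K0cls X +k K0cls X +k -k K0cls X); first by ring.
by rewrite -e; ring.
Qed.

Section Pivots.
Variables (X : zfunctor) (n : nat) (f : mor X (Aff n)).
Hypothesis eX : is_affine X.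

Definition lead_zero (k : nat) : subfunctor X :=
  pullback f (zero_sub (fun r : 'I_n => (r < k)%N)).

Lemma lead_zero_closed k : is_closed (lead_zero k).
Proof. by apply: closed_pullback; apply: closed_zero. Qed.

Lemma affine_lead_zero k : is_affine (sub (lead_zero k)).
Proof. by apply: affine_closed_sub => //; apply: lead_zero_closed. Qed.

Definition pivot_at (i : 'I_n) : subfunctor X := pullback f (pivot_sub i).

Lemma affine_pivot_at i : is_affine (sub (pivot_at i)).
Proof.
apply: affine_iso (affine_unit_locus (mor_comp f (incl (lead_zero i))) i (affine_lead_zero i)).
apply/iso_sym/iso_sub_sub => R x; split=> [[x0 xu]|[x0 xu]]; last by split.
by exists x0.
Qed.

(** Where the first [i] coordinates vanish, the next one is zero or, on the
complement, a pivot. *)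
Lemma K0_pivot_step (i : 'I_n) :
  K0cls (of_affine (affine_lead_zero i))
  ==K K0cls (of_affine (affine_lead_zero i.+1)) +k K0cls (of_affine (affine_pivot_at i)).
Proof.
pose Z : subfunctor (sub (lead_zero i)) := pullback (incl _) (lead_zero i.+1).
apply: (@K0scissor (of_affine (affine_lead_zero i)) (of_affine (affine_lead_zero i.+1))
  (of_affine (affine_pivot_at i)) Z).
- by apply: closed_pullback; apply: lead_zero_closed.
- apply/iso_sym/iso_sub_sub => R x; split=> [x0|[_]//].
  by unshelve eexists; [move=> j ji; apply: x0; apply: leqW|].
apply/iso_sym/iso_sub_sub => R x; split=> [[x0 xu]|[x0 xc]].
  exists x0 => S g /(_ i (leqnn _)) /=; rewrite mor_nat mxE.
  by move/unit_locus: xu; apply.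
split=> //; apply/unit_locus => S g gi; apply: (xc S g) => j.
rewrite /= mor_nat mxE ltnS leq_eqVlt => /orP[/eqP/val_inj->//|/x0->].
exact: rmorph0.
Qed.

End Pivots.

(** The recursion [[GL_(m+1)] = (L^(m+1) - 1) L^m [GL_m]], with the negative term moved
to the left.  Both [GL_(m+1)] and [A^(m+1)] are peeled by the number of leading
zeros, of the first column and of the vector; at each pivot the two
differences are proportional with the factor [L^m [GL_m]]. *)
Lemma K0_GL_rec m :
  K0cls (of_affine (affine_GL m.+1)) +k K0eval 'X^m *k K0cls (of_affine (affine_GL m))
  ==K K0eval 'X^(m.+1) *k (K0eval 'X^m *k K0cls (of_affine (affine_GL m))).
Proof.
set q := K0eval 'X^m *k _.
pose f := mor_comp (colv m) (incl (GL_sub m.+1)).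
pose g := mor_id (Aff m.+1).
pose Y k := K0cls (of_affine (affine_lead_zero f (affine_GL m.+1) k)).
pose W k := K0cls (of_affine (affine_lead_zero g (affine_Aff m.+1) k)).
have PV (i : 'I_m.+1) : K0cls (of_affine (affine_pivot_at f (affine_GL m.+1) i))
    ==K K0cls (of_affine (affine_pivot_at g (affine_Aff m.+1) i)) *k q.
  have -> : q ==K K0cls (of_affine (affine_prod (affine_Aff m) (affine_GL m))).
    rewrite /q -(K0_Aff (affine_variety (affine_Aff m))); symmetry; apply: K0prod.
    exact: iso_refl.
  apply: K0prod.
  pose D : subfunctor (Mat m.+1 m.+1) := andsub (pivot_mx i) (pullback (schur i) (GL_sub m)).
  apply: (@iso_trans _ (sub D)).
    apply: iso_sub_sub => R A; split=> [[pA sA]|[gA pA]].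
      by exists ((GL_schur pA).2 sA).
    by split; last exact/(GL_schur pA).1.
  by apply: (@iso_pivot m i (GL_sub m) D).
have tele k : (k <= m.+1)%N -> Y 0 +k W k *k q ==K Y k +k W 0 *k q.
  elim: k => [|k IHk] km; first by reflexivity.
  have sY : Y k ==K Y k.+1 +k _ := K0_pivot_step f (affine_GL m.+1) (Ordinal km).
  have sW : W k ==K W k.+1 +k _ := K0_pivot_step g (affine_Aff m.+1) (Ordinal km).
  have := IHk (ltnW km); rewrite sY sW PV => e.
  set v := K0cls (of_affine (affine_pivot_at g _ _)) in e.
  transitivity (Y 0 +k (W k.+1 +k v) *k q +k -k (v *k q)); first by ring.
  by rewrite e; ring.
have Y0 : Y 0 ==K K0cls (of_affine (affine_GL m.+1)).
  by apply: K0_iso; apply: iso_sub_full => R x j.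
(* No invertible matrix has a zero column, while the zero vector remains in [W]. *)
have Yn : Y m.+1 ==K 0k.
  apply: K0_empty => R [[A hA] A0]; have [B [_ BA]] := hA.
  have := congr1 (fun M : 'M_m.+1 => M 0 0) BA; rewrite !mxE eqxx big1 // => j _.
  by have := A0 j (ltn_ord j); rewrite [LHS]mxE /= => ->; rewrite mulr0.
have W0 : W 0 ==K K0eval 'X^(m.+1).
  rewrite -(K0_Aff (affine_variety (affine_Aff m.+1))).
  by apply: K0_iso; apply: iso_sub_full => R x j.
have Wn : W m.+1 ==K 1k.
  apply: K0pt.
  exists (@Mor (sub (lead_zero g m.+1)) pt (fun _ _ => tt) (fun _ _ _ _ => erefl)) => R.
  apply: inj_surj_bij => [[v v0] [w w0] _|[]].
    apply: eq_exist; apply/rowP => j.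
    by rewrite (v0 j (ltn_ord j)) (w0 j (ltn_ord j)).
  have h : lead_zero g m.+1 R (0 : 'rV_m.+1) by move=> j _; rewrite mxE.
  by exists (exist _ _ h).
have := tele m.+1 (leqnn _); rewrite Y0 Yn W0 Wn => e.
transitivity (K0cls (of_affine (affine_GL m.+1)) +k 1k *k q); first by ring.
by rewrite e; ring.
Qed.

Lemma K0_GL m : K0cls (of_affine (affine_GL m)) ==K K0eval ('X^(unip_dim m) * qpoch m).
Proof.
elim: m => [|m IHm].
  rewrite /qpoch big_nil mulr1 K0eval1; apply: K0pt.
  exists (@Mor (GL 0) pt (fun _ _ => tt) (fun _ _ _ _ => erefl)) => R.
  apply: inj_surj_bij => [[A hA] [B hB] _|[]].
    by apply: eq_exist; rewrite [LHS]flatmx0 [RHS]flatmx0.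
  by exists (exist _ _ (GL_0 (0 : 'M_0))).
have -> : 'X^(unip_dim m.+1) * qpoch m.+1
    = 'X^(m.+1) * ('X^m * ('X^(unip_dim m) * qpoch m)) - 'X^m * ('X^(unip_dim m) * qpoch m) :> {poly int}.
  rewrite /qpoch big_nat_recr //= exprD -/(qpoch m) -[in RHS](mulrC _ 'X^(m.+1)).
  by rewrite -[X in _ = _ - X]mulr1 -mulrBr !mulrA.
rewrite K0evalD K0evalN !K0evalM -K0evalM -IHm -K0_GL_rec.
by ring.
Qed.

(** * The class of the coproducts *)

(** The new component is the complement of [e_N = 0]: there [e_N] is an invertible
idempotent, hence [1]. *)
Lemma K0_coprod_step N X (eX : forall i, is_affine (X i)) :
  K0cls (of_affine (affine_coprod N.+1 eX))
  ==K K0cls (of_affine (affine_coprod N eX)) +k K0cls (of_affine (eX N)).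
Proof.
apply: (@K0scissor (of_affine (affine_coprod N.+1 eX)) (of_affine (affine_coprod N eX))
  (of_affine (eX N)) (last_zero N X)).
- exact: last_zero_closed.
- exact: closed_immersion_iso (coprod_incl_image N X).
have X0 i : zero_pt (X i) by apply/affine_zero_pt/eX.
pose C : subfunctor (coprod N.+1 X) := @comp_sub N.+1 X N (full_sub (X N)).
apply: (@iso_trans _ (sub C)); last first.
  apply: iso_sub_eq => R x; split=> [[h _] S f|xc].
    by rewrite /= h rmorph1.
  have /unit_locus[y xy] : forall (S : comPzRingType) (f : {rmorphism R -> S}),
      f (cp_idem x N) = 0 -> 1 = 0 :> S by move=> S f; apply: xc.
  have h : cp_idem x N = 1 by rewrite -[LHS]mulr1 -xy mulrA cp_mulee xy.
  by exists h.
apply: iso_sym; apply: iso_trans (iso_comp_sub X0 _ _) _ => //.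
exact: iso_sub_full.
Qed.

Lemma K0_coprod_GL N (h : is_variety (coprod N GL)) :
  K0cls (Variety h) ==K K0eval (qpoch_sum (fun m => 'X^(unip_dim m)) N).
Proof.
transitivity (K0cls (of_affine (affine_coprod N affine_GL))).
  by apply: K0iso; apply: iso_refl.
rewrite /qpoch_sum; elim: N {h} => [|N IHN].
  rewrite big_ord0 K0eval0; apply: K0_empty => R x.
  by rewrite -(cp_sum x) big_ord0.
rewrite big_ord_recr K0evalD K0_coprod_step IHN /= K0_GL. reflexivity.
Qed.

(** * Torification of affine space by coordinate tori *)

Section Torification.
Variable d : nat.

Definition coord_torus (S : {set 'I_d}) : mor (torus #|S|) (Aff d).
Proof.
exists (fun (R : comPzRingType) (x : torus #|S| R) =>
  \row_i \sum_(l < #|S| | enum_val l == i) (sval x : 'rV_#|S|) 0 l) => R R' f x.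
apply/rowP => i; rewrite !mxE rmorph_sum; apply: eq_bigr => l _.
by rewrite mxE.
Defined.

Lemma coord_torus_in (S : {set 'I_d}) (R : comPzRingType) (x : torus #|S| R) l :
  (coord_torus S R x : 'rV_d) 0 (enum_val l) = (sval x : 'rV_#|S|) 0 l.
Proof.
by rewrite mxE (big_pred1 l) // => l'; rewrite /= (inj_eq enum_val_inj).
Qed.

Lemma coord_torus_out (S : {set 'I_d}) (R : comPzRingType) (x : torus #|S| R) i :
  i \notin S -> (coord_torus S R x : 'rV_d) 0 i = 0.
Proof.
move=> iS; rewrite mxE big_pred0 // => l; apply: contraNF iS => /eqP <-.
exact: enum_valP.
Qed.

(** Invertibility of several coordinates is invertibility of their product, a single
function. *)
Definition coord_prod (S : {set 'I_d}) : mor (Aff d) (Aff 1).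
Proof.
exists (fun (R : comPzRingType) (v : 'rV[R]_d) => \row__ \prod_(i in S) v 0 i) => R R' f v.
apply/rowP => j; rewrite !mxE rmorph_prod; apply: eq_bigr => i _.
by rewrite mxE.
Defined.

Definition support_sub (S : {set 'I_d}) : subfunctor (Aff d) :=
  andsub (zero_sub (fun i => i \notin S)) (pullback (coord_prod S) (unit_sub ord0)).

Lemma support_subP (S : {set 'I_d}) (R : comPzRingType) (v : 'rV[R]_d) :
  support_sub S R v <-> (forall i, i \notin S -> v 0 i = 0) /\
    (forall i, i \in S -> exists y, v 0 i * y = 1).
Proof.
rewrite /= mxE; split=> -[v0 vu]; split=> //.
  move=> i iS; move: vu; rewrite (bigD1 i) //= => -[y e].
  by exists (\prod_(j in S | j != i) v 0 j * y); rewrite mulrA.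
elim/big_ind: _ => [|x y ux uy|i /vu//]; first by exists 1; rewrite mulr1.
exact/unit_mulP.
Qed.

Lemma lc_support S : is_locally_closed (support_sub S).
Proof.
apply: lc_closed_open; first exact: closed_zero.
by apply: open_pullback; apply: open_unit.
Qed.

Lemma coord_torus_image S : image_is (coord_torus S) (support_sub S).
Proof.
move=> R; split=> [x y xy|v].
  apply: sval_inj_prop; apply/rowP => l.
  by rewrite -!coord_torus_in xy.
rewrite support_subP; split=> [[v0 vu]|[x <-]].
  have h : torus_sub #|S| R (\row_l v 0 (enum_val l)).
    by move=> l; rewrite mxE; apply: vu; apply: enum_valP.
  exists (exist _ _ h); apply/rowP => i.
  have [iS|iS] := boolP (i \in S); last by rewrite coord_torus_out // v0.
  by rewrite -(enum_rankK_in iS iS) coord_torus_in mxE.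
split=> [i iS|i iS]; first exact: coord_torus_out.
rewrite -(enum_rankK_in iS iS) coord_torus_in.
exact: (svalP x).
Qed.

Definition torus_rank (j : 'I_#|{: {set 'I_d}}|) : nat := #|enum_val j|.

(** Over a field, the torus through a point is given by its support. *)
Lemma Aff_torification : has_torification (Aff d) torus_rank.
Proof.
exists (fun j => coord_torus (enum_val j)); split=> [j|K].
  by exists (support_sub (enum_val j)); split; [apply: lc_support|apply: coord_torus_image].
have supp (S : {set 'I_d}) (x : torus #|S| K) i : (i \in S) = ((coord_torus S K x : 'rV_d) 0 i != 0).
  have [iS|iS] := boolP (i \in S); last by rewrite coord_torus_out ?eqxx.
  have [_ /(_ (coord_torus S K x))[_ h]] := coord_torus_image S K.
  have /support_subP[_ /(_ i iS)[y e]] := h (ex_intro _ x erefl).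
  by apply/esym; apply: contra_eq_neq e => ->; rewrite mul0r eq_sym oner_eq0.
apply: inj_surj_bij => [[j x] [j' x'] e|v].
  have {}e : coord_torus (enum_val j) K x = coord_torus (enum_val j') K x' by exact: e.
  have jj : j = j'.
    by apply: enum_val_inj; apply/setP => i; rewrite (supp _ x) (supp _ x') e.
  subst j'; congr existT; have [inj _] := coord_torus_image (enum_val j) K.
  exact: inj.
pose S := [set i | (v : 'rV_d) 0 i != 0].
have [j jS] : exists j : 'I_#|{: {set 'I_d}}|, enum_val j = S.
  by exists (enum_rank S); rewrite enum_rankK.
have [_ /(_ v)[h _]] := coord_torus_image (enum_val j) K.
have [|x xv] := h.
  apply/support_subP; rewrite jS; split=> i; rewrite inE.
    by rewrite negbK => /eqP.
  by move=> vi; exists ((v : 'rV_d) 0 i)^-1; rewrite divff.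
by exists (Tagged (fun j => torus (torus_rank j) K) x).
Qed.

(** Expand the power of [X = (X - 1) + 1] over the subsets of the coordinates. *)
Lemma torus_rank_sum :
  \sum_(j < #|{: {set 'I_d}}|) ('X - 1) ^+ torus_rank j = 'X^d :> {poly int}.
Proof.
transitivity (\sum_(S : {set 'I_d}) ('X - 1) ^+ #|S| : {poly int}).
  rewrite [RHS](reindex (fun j : 'I_#|{: {set 'I_d}}| => enum_val j)) //=.
  exact: onW_bij (enum_val_bij _).
transitivity (\prod_(i < d) (('X - 1) + 1) : {poly int}); last first.
  by rewrite prodr_const card_ord subrK.
rewrite bigA_distr; apply: eq_bigr => S _.
by rewrite -big_mkcond prodr_const.
Qed.

End Torification.

(** * Point counts *)

Lemma has_card_bij (T U : Type) c (f : T -> U) : bijective f -> has_card T c -> has_card U c.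
Proof. by move=> fB [g gB]; exists (f \o g); apply: bij_comp. Qed.

Lemma has_card_fin (T : finType) : has_card T #|T|.
Proof. by exists enum_val; apply: enum_val_bij. Qed.

Lemma has_card_sig (T : finType) (P : T -> Prop) (p : pred T) :
  (forall x, reflect (P x) (p x)) -> has_card {x | P x} #|p|.
Proof.
move=> pP; have h (i : 'I_#|p|) : P (enum_val i) by apply/pP/enum_valP.
exists (fun i => exist P (enum_val i) (h i)); apply: inj_surj_bij.
  by move=> i j [] /enum_val_inj.
move=> [x Px]; have px : x \in p by apply/pP.
by exists (enum_rank_in px x); apply: eq_exist; rewrite enum_rankK_in.
Qed.

Lemma Posz_exp (m n : nat) : (m ^ n)%N%:Z = m%:Z ^+ n.
Proof. by rewrite -!natz natrX. Qed.

Lemma count_Aff d : is_counting_poly (Aff d) 'X^d.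
Proof.
move=> F; exists #|{: 'rV[F]_d}|; split; first exact: has_card_fin.
by rewrite card_mx mul1n hornerXn Posz_exp.
Qed.

Lemma card_unitmx (F : finFieldType) m :
  #|[pred A : 'M[F]_m | A \in unitmx]|
  = (#|F| ^ 'C(m, 2) * \prod_(1 <= i < m.+1) (#|F| ^ i - 1))%N.
Proof.
case: m => [|m].
  rewrite big_nil; transitivity #|{: 'M[F]_0}|; last by rewrite card_mx.
  apply: eq_card => A.
  by rewrite !inE unitmxE det_mx00 unitr1.
by rewrite -card_GL // cardsT /= card_sub; apply: eq_card => A; rewrite !inE.
Qed.

Lemma horner_qpoch m (x : int) :
  (qpoch m).[x] = \prod_(1 <= i < m.+1) (x ^+ i - 1).
Proof.
by rewrite /qpoch horner_prod; apply: eq_bigr => i _; rewrite !hornerE.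
Qed.

Lemma unip_dim_bin m : unip_dim m = 'C(m, 2).
Proof. by elim: m => //= m ->; rewrite binS bin1 addnC. Qed.

Lemma count_GL m : is_counting_poly (GL m) ('X^(unip_dim m) * qpoch m).
Proof.
move=> F; exists #|[pred A : 'M[F]_m | A \in unitmx]|; split.
  apply: has_card_sig => A; apply: (iffP idP) => [uA|[B [AB _]]].
    by exists (invmx A); rewrite mulmxV // mulVmx.
  by have [] := mulmx1_unit AB.
rewrite card_unitmx hornerM hornerXn horner_qpoch unip_dim_bin PoszM Posz_exp.
congr (_ * _); rewrite (big_morph Posz PoszM erefl); apply: eq_bigr => i _.
by rewrite -subzn ?expn_gt0 ?Posz_exp // (ltn_trans _ (card_finRing_gt1 F)).
Qed.

(** Spectra of fields are connected, so that the points of a coproduct over a field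
are those of its components. *)
Lemma count_coprod N (X : nat -> zfunctor) (P : nat -> {poly int}) :
  (forall i, zero_pt (X i)) -> (forall i, is_counting_poly (X i) (P i)) ->
  is_counting_poly (coprod N X) (\sum_(i < N) P i).
Proof.
move=> X0 hP F; pose c i := sval (cid (hP i F)).
have [cc cP] : (forall i, has_card (X i F) (c i)) /\ (forall i, (c i)%:Z = (P i).[#|F|%:Z]).
  by split=> i; rewrite /c; case: cid => ? [].
exists (\sum_(i < N) c i)%N; split; last first.
  rewrite horner_sum (big_morph Posz PoszD erefl).
  by apply: eq_bigr => i _; rewrite cP.
pose g i := sval (cid (cc i)).
have gB i : bijective (g i) by rewrite /g; case: cid.
pose T := {i : 'I_N & 'I_(c i)}.
have -> : (\sum_(i < N) c i = #|{: T}|)%N.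
  rewrite card_tagged sumnE big_map big_enum /=.
  by apply: eq_bigr => i _; rewrite card_ord.
pose G (p : T) : coprod N X F := sval (cid (coprod_in X0 (g _ (tagged p)) (ltn_ord (tag p)))).
have GP (p : T) : exists h : cp_idem (G p) (tag p) = 1, at_pt h = g _ (tagged p).
  by rewrite /G; case: cid.
apply: (has_card_bij (f := G) _ (has_card_fin T)).
apply: inj_surj_bij => [[i k] [j l] e|x].
  have [/= h hE] := GP (Tagged (fun i : 'I_N => 'I_(c i)) k).
  have [/= h' hE'] := GP (Tagged (fun i : 'I_N => 'I_(c i)) l).
  rewrite /= in e h hE h' hE' *.
  move: h h' hE hE'; rewrite e => h h' hE hE'.
  have ij := val_inj (coprod_field_uniq h h'); subst j.
  congr existT; apply: (bij_inj (gB i)).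
  by rewrite -hE -hE'; congr at_pt; apply: Prop_irrelevance.
have [i h] := coprod_field x.
have [k kE] := bij_surj (gB i) (at_pt h).
exists (Tagged (fun i : 'I_N => 'I_(c i)) k).
have [/= h' hE] := GP (Tagged (fun i : 'I_N => 'I_(c i)) k).
by apply: (at_pt_inj X0 (hx := h') (hy := h)); rewrite hE.
Qed.

(** * Signs *)

(** The bound on [q] excludes only [q = 0] among the values [1 - n] with [n] odd, that
is [n = 1], where the sum has a single term. *)
Section Signs.
Variable q : int.
Hypothesis q_le : q <= - 2%:Z.

Let gl_term m : int := q ^+ unip_dim m * \prod_(1 <= i < m.+1) (q ^+ i - 1).

Lemma gl_term_rec m : gl_term m.+1 = gl_term m * (q ^+ m * (q ^+ m.+1 - 1)).
Proof. by rewrite /gl_term big_nat_recr //= exprD [q ^+ m * _]mulrC mulrACA. Qed.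

Lemma even_power_ge1 k : 1 <= q ^+ (k.*2).
Proof. 
rewrite -muln2 mulnC exprM; apply: exprn_ege1.
by rewrite expr2; nia.
Qed.

Lemma even_step k : q ^+ k.*2 * (q ^+ k.*2.+1 - 1) <= 0.
Proof.
rewrite exprS; have := even_power_ge1 k; set p := q ^+ _ => p1.
have qp : q * p <= - 2%:Z by nia.
by move: (q * p) qp => r rp; nia.
Qed.

(** A term of odd index plus its successor is the term times this number. *)
Lemma odd_step k : 1 + q ^+ k.*2.+1 * (q ^+ k.*2.+2 - 1) <= 0.
Proof.
rewrite exprS [q ^+ _.+2]exprS exprS; have := even_power_ge1 k; set p := q ^+ _ => p1.
have qp : q * p <= - 2%:Z by nia.
move: (q * p) qp => r rp.
have qr : 4 <= q * r by nia.
by move: (q * r) qr => t tq; nia.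
Qed.

Lemma even_term_ge0 k : 0 <= gl_term k.*2.
Proof.
elim: k => [|k IHk]; first by rewrite /gl_term big_nil expr0.
rewrite doubleS !gl_term_rec -mulrA.
have := even_step k; have := odd_step k.
set x := _ * (_ - 1); set y := _ * (_ - 1); nia.
Qed.

Lemma odd_term_le0 k : gl_term k.*2.+1 <= 0.
Proof. by rewrite gl_term_rec; have := even_term_ge0 k; have := even_step k; set x := _ * (_ - 1); nia. Qed.

Lemma odd_sum_ge0 k : 0 <= \sum_(m < k.*2.+1) gl_term m.
Proof.
elim: k => [|k IHk]; first by rewrite big_ord1; apply: (even_term_ge0 0).
rewrite doubleS big_ord_recr big_ord_recr /= [gl_term _.+2]gl_term_rec.
have := odd_term_le0 k; have := odd_step k; move: IHk.
set s := \sum_(_ < _) _; set x := _ * (_ - 1); nia.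
Qed.

End Signs.

(** * The F_1-structure *)

Lemma GL_ind_variety : is_ind_variety GL_ind.
Proof.
split=> N; first exact/affine_variety/affine_coprod/affine_GL.
exact: coprod_incl_closed.
Qed.

Definition GL_F1_data : F1_data :=
  @F1Data (fun m => of_affine (affine_Aff (unip_dim m))) (fun m => #|{: {set 'I_(unip_dim m)}}|)
    (fun m => @torus_rank (unip_dim m)).

Lemma GL_F1_alpha : F1_alpha GL_F1_data = fun m => 'X^(unip_dim m).
Proof. by apply/funext => m; apply: torus_rank_sum. Qed.

Lemma count_coprod_GL N :
  is_counting_poly (coprod N GL) (qpoch_sum (fun m => 'X^(unip_dim m)) N).
Proof.
apply: (@count_coprod N GL (fun m => 'X^(unip_dim m) * qpoch m)) => i.
  exact/affine_zero_pt/affine_GL.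
exact: count_GL.
Qed.

Lemma GL_F1_structure : is_F1_structure GL_ind_variety GL_F1_data.
Proof.
have refl N P : eqmod_poly (qpoch N) P P by exists 0; rewrite subrr mul0r.
rewrite /is_F1_structure GL_F1_alpha; split; split.
- by move=> N _; apply: piecewise_GL.
- by move=> m; apply: Aff_torification.
- by move=> m; apply: K0_Aff.
- move=> N _; exists (qpoch_sum (fun m => 'X^(unip_dim m)) N); split=> //.
  exact: K0_coprod_GL.
- by move=> m; apply: count_Aff.
move=> N _; exists (qpoch_sum (fun m => 'X^(unip_dim m)) N); split=> //.
exact: count_coprod_GL.
Qed.

(** The truncated Habiro series is the counting polynomial itself, not only modulo
[qpoch n]. *)
Lemma qpoch_sum_GL n : (1 <= n)%N ->
  qpoch_sum (fun m => 'X^(unip_dim m)) n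
  = 1 + \sum_(1 <= m < n)
          'X^((m * (m - 1))./2) * \prod_(1 <= i < m.+1) ('X^i - 1).
Proof.
move=> n1; rewrite /qpoch_sum -(big_mkord xpredT (fun m => 'X^(unip_dim m) * qpoch m)).
rewrite big_ltn // /qpoch big_nil mulr1 expr0; congr (1 + _).
by apply: eq_bigr => m _; rewrite unip_dim_bin bin2 subn1.
Qed.

Lemma qpoch_sum_ge0 n : odd n ->
  0 <= (qpoch_sum (fun m => 'X^(unip_dim m)) n).[1 - n%:Z].
Proof.
move=> on; rewrite /qpoch_sum horner_sum.
under eq_bigr => m _ do rewrite hornerM hornerXn horner_qpoch.
rewrite -(odd_double_half n) on add1n.
case: n./2 => [|k]; first by rewrite big_ord1 big_nil.
by apply: odd_sum_ge0; lia.
Qed.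

Theorem proposition7p1 :
  let NX (n : nat) : {poly int} :=
    1 + \sum_(1 <= m < n)
          'X^((m * (m - 1))./2) * \prod_(1 <= i < m.+1) ('X^i - 1) in
  [/\ forall n : nat, (1 <= n)%N -> is_counting_poly (coprod n GL) (NX n),
      forall n : nat, (1 <= n)%N -> odd n -> 0 <= (NX n).[1 - n%:Z]
    & forall (zeta : algC) (n : nat),
        n.-primitive_root zeta -> odd n -> has_Fzeta_structure zeta GL_ind].
Proof.
move=> NX; split=> [n n1|n n1 on|zeta n zn on].
- by rewrite /NX -qpoch_sum_GL //; apply: count_coprod_GL.
- by rewrite /NX -qpoch_sum_GL //; apply: qpoch_sum_ge0.
exists n, GL_ind_variety, GL_F1_data; split=> //.
- exact: GL_F1_structure.
- by rewrite GL_F1_alpha; apply: count_coprod_GL.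
by rewrite GL_F1_alpha; apply: qpoch_sum_ge0.
Qed.
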